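(* Let $S$ be a compact, connected, non-positively curved special cube complex, $\Gamma$ its fundamental group, $X$ its universal covering, and $\ell:\vec{\mathcal E}(X)\to\Sigma_0$ a surjective $\Gamma$-invariant admissible edge labeling on $X$. Suppose the action of $\Gamma$ on $X$ is vertex-transitive. Then the following are equivalent: (1) The automorphism group $\mathrm{Aut}(X)$ is non-discrete. (2) There exist distinct $s,t\in\Sigma_0$ such that $s\neq t^{-1}$ and $[s,t]\neq1$. (3) $\Gamma$ is not free abelian.
   Context: $\mathrm{Aut}(X)$ is the group of cubical automorphisms of $X$ with the compact-open topology. ''Special'' is in the sense of Haglund--Wise (hyperplanes are embedded and two-sided, do not directly self-osculate, and do not inter-osculate). The trivial group counts as free abelian (of rank $0$). $\vec{\mathcal E}(X)$ is the set of oriented edges, $\vec{\mathcal E}(X)_v$ those starting at $v$. Oriented edges are parallel if they cross the same hyperplane in the same direction. Two edges with exactly one common endpoint span a square if they are two sides of a common square. An admissible edge labeling is a map $\ell:\vec{\mathcal E}(X)\to\Sigma_0$ to a finite set $\Sigma_0$ with fixpoint-free involution $s\mapsto s^{-1}$ such that: (A1) parallel oriented edges have equal labels and reversing orientation inverts the label; (A2) $\ell|_{\vec{\mathcal E}(X)_v}$ is injective for each vertex $v$; (A3) if $e_1,e_2\in\vec{\mathcal E}(X)_v$, $e_1',e_2'\in\vec{\mathcal E}(X)_w$ with $\ell(e_i)=\ell(e_i')$ for $i=1,2$, then $e_1,e_2$ span a square iff $e_1',e_2'$ do. It is $\Gamma$-invariant if $\ell(g(e))=\ell(e)$ for all $g\in\Gamma$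 and all $e$. Labels $s,t\in\Sigma_0$ commute, written $[s,t]=1$, if at some vertex there are outgoing edges labeled $s$ and $t$ that span a square; $[s,t]\neq1$ means they do not commute. *)

(* Defs.v *)
From HB Require Import structures.
From Stdlib Require Import Relation_Operators.
From mathcomp Require Import all_boot all_order all_algebra.
From mathcomp Require Import all_classical all_reals all_analysis.
From mathcomp.multinomials Require Import freeg.

Set Implicit Arguments.
Unset Strict Implicit.
Unset Printing Implicit Defensive.

Import Order.TTheory GRing.Theory Num.Theory.
Import numFieldNormedType.Exports.

Local Open Scope classical_set_scope.
Local Open Scope quotient_scope.
Local Open Scope ring_scope.

(* An isometric embedding of the standard cube [0,1]^m onto a face of
   [0,1]^n, given by the image [fcorner] of the origin and the (injective)
   assignment [fdir] of coordinate directions.  For m = n these are the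
   symmetries of the n-cube. *)
Record face_map (m n : nat) := FaceMap {
  fcorner : {ffun 'I_n -> bool};
  fdir : {ffun 'I_m -> 'I_n};
  fdir_inj : injectiveb fdir
}.

Definition fapply m n (f : face_map m n) (b : {ffun 'I_m -> bool}) :
    {ffun 'I_n -> bool} :=
  [ffun j => fcorner f j (+) [exists i, (fdir f i == j) && b i]].

Lemma fid_inj n : injectiveb [ffun i : 'I_n => i].
Proof. by apply/injectiveP => i j; rewrite !ffunE. Qed.

Definition fid n : face_map n n := FaceMap [ffun=> false] (fid_inj n).

Lemma fcomp_inj k m n (g : face_map m n) (f : face_map k m) :
  injectiveb [ffun i => fdir g (fdir f i)].
Proof.
apply/injectiveP => i j; rewrite !ffunE.
by move/(injectiveP _ (fdir_inj g))/(injectiveP _ (fdir_inj f)).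
Qed.

Definition fcomp k m n (g : face_map m n) (f : face_map k m) : face_map k n :=
  FaceMap (fapply g (fcorner f)) (fcomp_inj g f).

Lemma fvertex_inj n (d : {ffun 'I_0 -> 'I_n}) : injectiveb d.
Proof. by apply/injectiveP => -[]. Qed.

Lemma fedge_inj n (d : {ffun 'I_1 -> 'I_n}) : injectiveb d.
Proof. by apply/injectiveP => i j _; rewrite (ord1 i) (ord1 j). Qed.

Definition no_dir (n : nat) (i : 'I_0) : 'I_n :=
  match notF (ltn_ord i) with end.

Definition fvertex n (b : {ffun 'I_n -> bool}) : face_map 0 n :=
  FaceMap b (fvertex_inj (finfun (@no_dir n))).

Definition fedge n (b : {ffun 'I_n -> bool}) (i : 'I_n) : face_map 1 n :=
  FaceMap b (fedge_inj [ffun=> i]).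

(* A cube complex (cubes glued along faces by isometries; cubes need not be
   embedded), presented by its characteristic maps: [cell n] is the set of
   parametrized n-cubes [0,1]^n -> X, so that an n-cube of X is an orbit of
   [cell n] under the 2^n n! symmetries of [0,1]^n, and [face c f] is the
   precomposition of c with f.  [face_free] says that a characteristic map is
   injective on the open cube. *)
Record cubeComplex := CubeComplex {
  cell : nat -> choiceType;
  face : forall m n, cell n -> face_map m n -> cell m;
  face_id : forall n (c : cell n), face c (fid n) = c;
  face_comp : forall k m n (c : cell n) (g : face_map m n) (f : face_map k m),
    face (face c g) f = face c (fcomp g f);
  face_free : forall n (c : cell n) (f : face_map n n),
    face c f = c -> f = fid n
}.

Notation vertex X := (cell X 0).
(* a parametrized 1-cube is the same as an oriented edge *)
Notation oedge X := (cell X 1).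

Section CubeComplexTheory.
Variable X : cubeComplex.

Definition vertex_at n (c : cell X n) (b : {ffun 'I_n -> bool}) : vertex X :=
  face c (fvertex b).

(* the edge of c in direction i, leaving from the corner b of c *)
Definition edge_at n (c : cell X n) (b : {ffun 'I_n -> bool}) (i : 'I_n) :
  oedge X := face c (fedge b i).

Definition origin n (c : cell X n) : vertex X := vertex_at c [ffun=> false].
Definition terminus (e : oedge X) : vertex X := vertex_at e [ffun=> true].
Definition redge (e : oedge X) : oedge X := edge_at e [ffun=> true] ord0.

Definition sq_bottom (c : cell X 2) : oedge X := edge_at c [ffun=> false] ord0.
Definition sq_left (c : cell X 2) : oedge X := edge_at c [ffun=> false] ord_max.
Definition sq_top (c : cell X 2) : oedge X :=
  edge_at c [ffun j => j == ord_max] ord0.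
Definition sq_right (c : cell X 2) : oedge X :=
  edge_at c [ffun j => j == ord0] ord_max.

(* Every pair of opposite sides of a square is of this form for a suitable
   parametrization of that square. *)
Definition opposite (e f : oedge X) : Prop :=
  exists c : cell X 2, e = sq_bottom c /\ f = sq_top c.

(* crossing the same hyperplane in the same direction *)
Definition parallel : oedge X -> oedge X -> Prop :=
  clos_refl_sym_trans _ opposite.

Definition same_hyperplane (e f : oedge X) : Prop :=
  parallel e f \/ parallel e (redge f).

(* consecutive outgoing edges at some corner of a square *)
Definition corner (e f : oedge X) : Prop :=
  exists c : cell X 2, e = sq_bottom c /\ f = sq_left c.

Definition two_sided : Prop := forall e, ~ parallel e (redge e).

Definition embedded_hyperplanes : Prop :=
  forall e f, corner e f -> ~ same_hyperplane e f.

(* Edges sharing their terminus are covered too, by reversing both. *)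
Definition directly_self_osculates (e f : oedge X) : Prop :=
  [/\ origin e = origin f, e <> f, parallel e f & ~ corner e f].

(* the hyperplanes of e and f are distinct, cross, and osculate at the common
   origin of e and f *)
Definition inter_osculate (e f : oedge X) : Prop :=
  [/\ ~ same_hyperplane e f, origin e = origin f, ~ corner e f &
      exists e' f', [/\ corner e' f', same_hyperplane e e' &
                        same_hyperplane f f']].

Definition special : Prop :=
  [/\ embedded_hyperplanes, two_sided,
      forall e f, ~ directly_self_osculates e f &
      forall e f, ~ inter_osculate e f].

(* Links of vertices are flag simplicial complexes.  The vertices of the link
   of v are the oriented edges leaving v, its simplices the corners of cubes at
   v.  The first clause excludes degenerate simplices; in the second one,
   existence is flagness and uniqueness says that a simplex is determined by
   its vertices. *)
Definition nonpositively_curved : Prop :=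
  (forall n (c : cell X n), injective (edge_at c [ffun=> false])) /\
  (forall (v : vertex X) n (e : 'I_n -> oedge X),
     (forall i, origin (e i) = v) ->
     (forall i j, i != j -> corner (e i) (e j)) ->
     exists! c : cell X n,
       origin c = v /\ forall i, edge_at c [ffun=> false] i = e i).

Fixpoint is_path (v : vertex X) (p : seq (oedge X)) (w : vertex X) : bool :=
  if p is e :: p' then (origin e == v) && is_path (terminus e) p' w
  else v == w.

Definition epath (v w : vertex X) : choiceType :=
  {p : seq (oedge X) | is_path v p w}.

Inductive elem_homotopy : seq (oedge X) -> seq (oedge X) -> Prop :=
| homotopy_backtrack p e q : elem_homotopy (p ++ [:: e, redge e & q]) (p ++ q)
| homotopy_square p c q :
    elem_homotopy (p ++ [:: sq_bottom c, sq_right c & q])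
                  (p ++ [:: sq_left c, sq_top c & q]).

(* homotopy of edge paths relative to their endpoints *)
Definition homotopic (v w : vertex X) : epath v w -> epath v w -> Prop :=
  clos_refl_sym_trans _ (fun p q => elem_homotopy (val p) (val q)).

Lemma is_path_nil v : is_path v [::] v.
Proof. exact: eqxx. Qed.

Lemma is_path_cat u v w p q :
  is_path u p v -> is_path v q w -> is_path u (p ++ q) w.
Proof.
elim: p u => [u /eqP-> //|e p IHp u /= /andP[-> /IHp]]; exact.
Qed.

Definition nil_path v : epath v v := exist _ [::] (is_path_nil v).

Definition cat_path u v w (p : epath u v) (q : epath v w) : epath u w :=
  exist _ (val p ++ val q) (is_path_cat (valP p) (valP q)).

Definition simply_connected : Prop :=
  (forall v w : vertex X, inhabited (epath v w)) /\
  (forall v (p : epath v v), homotopic p (nil_path v)).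

Lemma origin_redge e : origin (redge e) = terminus e.
Proof.
rewrite /origin /terminus /redge /edge_at /vertex_at face_comp; congr face.
rewrite /fcomp /fvertex.
set b := fapply _ _; have -> : b = [ffun=> true].
  apply/ffunP => j; rewrite !ffunE /=.
  by case: existsP => // -[i]; rewrite !ffunE andbF.
move: (fcomp_inj _ _); set d := [ffun i => _] => h.
have e0 : d = finfun (@no_dir 1) by apply/ffunP => -[].
by rewrite e0 in h *; congr FaceMap; exact: bool_irrelevance.
Qed.

Lemma terminus_redge e : terminus (redge e) = origin e.
Proof.
rewrite /origin /terminus /redge /edge_at /vertex_at face_comp; congr face.
rewrite /fcomp /fvertex.
set b := fapply _ _; have -> : b = [ffun=> false].
  apply/ffunP => j; rewrite !ffunE /=.
  by case: existsP => // -[]; exists ord0; rewrite !ffunE (ord1 j) eqxx.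
move: (fcomp_inj _ _); set d := [ffun i => _] => h.
have e0 : d = finfun (@no_dir 1) by apply/ffunP => -[].
by rewrite e0 in h *; congr FaceMap; exact: bool_irrelevance.
Qed.

Lemma is_path_inv v p w :
  is_path v p w -> is_path w (rev (map redge p)) v.
Proof.
elim: p v => [v /eqP-> //=|e p IHp v /= /andP[/eqP <- /IHp hp]].
rewrite rev_cons -cats1; apply: is_path_cat hp _ => /=.
by rewrite origin_redge terminus_redge !eqxx.
Qed.

Definition inv_path v w (p : epath v w) : epath w v :=
  exist _ (rev (map redge (val p))) (is_path_inv (valP p)).

Lemma redgeK : involutive redge.
Proof.
move=> e; rewrite /redge /edge_at face_comp -[RHS]face_id; congr face.
rewrite /fcomp /fid.
set b := fapply _ _; have -> : b = [ffun=> false].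
  apply/ffunP => j; rewrite !ffunE /=.
  by case: existsP => // -[]; exists ord0; rewrite !ffunE (ord1 j) eqxx.
move: (fcomp_inj _ _); set d := [ffun i => _] => h.
have e0 : d = [ffun i => i] by apply/ffunP => i; rewrite !ffunE (ord1 i).
by rewrite e0 in h *; congr FaceMap; exact: bool_irrelevance.
Qed.

Lemma homotopic_cat u v w (p p' : epath u v) (q q' : epath v w) :
  homotopic p p' -> homotopic q q' ->
  homotopic (cat_path p q) (cat_path p' q').
Proof.
move=> hp hq; apply: (@rst_trans _ _ _ (cat_path p' q)).
  elim: hp => {p p'} [p p' m|p|p p' _|p p' p'' _ h _].
  - apply: rst_step => /=; case: m => [a e b|a c b]; rewrite -!catA /=.
      exact: homotopy_backtrack.
    exact: homotopy_square.
  - exact: rst_refl.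
  - exact: rst_sym.
  - exact: rst_trans h.
elim: hq => {q q'} [q q' m|q|q q' _|q q' q'' _ h _].
- apply: rst_step => /=; case: m => [a e b|a c b]; rewrite !catA.
    exact: homotopy_backtrack.
  exact: homotopy_square.
- exact: rst_refl.
- exact: rst_sym.
- exact: rst_trans h.
Qed.

Lemma homotopic_invl v w (p : epath v w) :
  homotopic (cat_path (inv_path p) p) (nil_path w).
Proof.
case: p => p; elim: p v => [|e p IHp] v hp.
  have /eqP evw := hp; subst w.
  rewrite (_ : cat_path _ _ = nil_path v); first exact: rst_refl.
  exact: val_inj.
have /andP[/eqP ov hp'] := hp.
apply: rst_trans (IHp _ hp'); apply: rst_step => /=.
rewrite rev_cons cat_rcons.
have := homotopy_backtrack (rev (map redge p)) (redge e) p.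
by rewrite redgeK.
Qed.

Lemma homotopic_invr v w (p : epath v w) :
  homotopic (cat_path p (inv_path p)) (nil_path v).
Proof.
suff pK : inv_path (inv_path p) = p.
  by have := homotopic_invl (inv_path p); rewrite pK.
apply: val_inj => /=; rewrite map_rev revK -map_comp.
by rewrite (eq_map (g := id)) ?map_id // => e /=; rewrite redgeK.
Qed.

Section FundamentalGroup.
Variable v : vertex X.

Definition homotopicb (p q : epath v v) : bool := `[< homotopic p q >].

Lemma homotopicb_refl : reflexive homotopicb.
Proof. by move=> p; apply/asboolP; exact: rst_refl. Qed.

Lemma homotopicb_sym : symmetric homotopicb.
Proof. by move=> p q; apply/asboolP/asboolP; exact: rst_sym. Qed.

Lemma homotopicb_trans : transitive homotopicb.
Proof.
by move=> q p r /asboolP pq /asboolP qr; apply/asboolP; exact: rst_trans qr.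
Qed.

Definition homotopy_rel :=
  EquivRel _ homotopicb_refl homotopicb_sym homotopicb_trans.

Definition pi1 := {eq_quot homotopy_rel}.

HB.instance Definition _ := Choice.on pi1.
HB.instance Definition _ := Quotient.on pi1.
HB.instance Definition _ := EqQuotient.on pi1.

Definition pi1_mul (a b : pi1) : pi1 := \pi_pi1 (cat_path (repr a) (repr b)).
Definition pi1_one : pi1 := \pi_pi1 (nil_path v).
Definition pi1_inv (a : pi1) : pi1 := \pi_pi1 (inv_path (repr a)).

Lemma pi1P (p q : epath v v) : homotopic p q <-> \pi_pi1 p = \pi_pi1 q.
Proof.
by split=> [h|/eqmodP/asboolP//]; apply/eqmodP/asboolP.
Qed.

Lemma repr_pi (p : epath v v) : homotopic (repr (\pi_pi1 p)) p.
Proof. by apply/pi1P; rewrite reprK. Qed.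

Lemma pi1_mulE (p q : epath v v) :
  pi1_mul (\pi_pi1 p) (\pi_pi1 q) = \pi_pi1 (cat_path p q).
Proof. by apply/pi1P; apply: homotopic_cat; exact: repr_pi. Qed.

Lemma pi1_mulA : associative pi1_mul.
Proof.
move=> a b c; move: (reprK a) (reprK b) (reprK c).
move: (repr a) (repr b) (repr c) => p q r <- <- <-.
rewrite (pi1_mulE q r) (pi1_mulE p q) !pi1_mulE.
by apply: (congr1 \pi_pi1); apply: val_inj; rewrite /= catA.
Qed.

Lemma pi1_mul1g : left_id pi1_one pi1_mul.
Proof.
move=> a; move: (reprK a); move: (repr a) => p <-; rewrite pi1_mulE.
by apply: (congr1 \pi_pi1); exact: val_inj.
Qed.

Lemma pi1_mulg1 : right_id pi1_one pi1_mul.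
Proof.
move=> a; move: (reprK a); move: (repr a) => p <-; rewrite pi1_mulE.
by apply: (congr1 \pi_pi1); apply: val_inj; rewrite /= cats0.
Qed.

Lemma pi1_mulVg : left_inverse pi1_one pi1_inv pi1_mul.
Proof.
move=> a; rewrite -{2}(reprK a) pi1_mulE.
by apply/pi1P; exact: homotopic_invl.
Qed.

Lemma pi1_mulgV : right_inverse pi1_one pi1_inv pi1_mul.
Proof.
move=> a; rewrite -{1}(reprK a) pi1_mulE.
by apply/pi1P; exact: homotopic_invr.
Qed.

HB.instance Definition _ := isGroup.Build pi1
  pi1_mulA pi1_mul1g pi1_mulg1 pi1_mulVg pi1_mulgV.

End FundamentalGroup.
End CubeComplexTheory.

Definition free_abelian (G : groupType) : Prop :=
  exists (I : choiceType) (phi : {freeg I} -> G),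
    bijective phi /\ forall x y, phi (x + y) = (phi x * phi y)%g.

Record cubical_map (X Y : cubeComplex) := CubicalMap {
  cmap :> forall n, cell X n -> cell Y n;
  cmap_face : forall m n (c : cell X n) (f : face_map m n),
    cmap (face c f) = face (cmap c) f
}.

Record automorphism (X : cubeComplex) := Automorphism {
  aut_map :> cubical_map X X;
  aut_bij : forall n, bijective (@aut_map n)
}.

HB.instance Definition _ X := gen_eqMixin (automorphism X).
HB.instance Definition _ X := gen_choiceMixin (automorphism X).

(* A combinatorial covering map: unique lifting of cubes at each vertex, that
   is, an isomorphism on the links of vertices. *)
Definition covering X S (p : cubical_map X S) : Prop :=
  (forall v : vertex S, exists x : vertex X, p _ x = v) /\
  (forall (x : vertex X) n (c : cell S n), origin c = p _ x ->
     exists! c' : cell X n, origin c' = x /\ p _ c' = c).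

Definition universal_covering X S (p : cubical_map X S) : Prop :=
  covering p /\ simply_connected X.

(* [deck_action p x0 a g]: the element a of the fundamental group of S at
   p x0 acts on the universal covering X as g, the deck transformation
   carrying x0 to the end of the lift at x0 of a loop representing a. *)
Definition deck_action X S (p : cubical_map X S) (x0 : vertex X)
    (a : pi1 (p 0%N x0)) (g : automorphism X) : Prop :=
  (forall n (c : cell X n), p _ (g _ c) = p _ c) /\
  exists (q : epath x0 (g 0%N x0)) (r : epath (p 0%N x0) (p 0%N x0)),
    val r = map (@p 1%N) (val q) /\ a = \pi_(pi1 (p 0%N x0)) r.

Definition vertex_transitive X S (p : cubical_map X S) (x0 : vertex X) :=
  forall x y : vertex X,
    exists a g, deck_action (p := p) (x0 := x0) a g /\ g _ x = y.

Section Realization.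
Variable R : realType.

Definition geometric_cube (n : nat) : set 'rV[R]_n :=
  [set t | forall i, 0 <= t ord0 i <= 1].
Arguments geometric_cube n : clear implicits.

(* the affine extension of a face map to a map [0,1]^m -> [0,1]^n *)
Definition gapply m n (f : face_map m n) (t : 'rV[R]_m) : 'rV[R]_n :=
  \row_j if [pick i | fdir f i == j] is Some i
         then (if fcorner f j then 1 - t ord0 i else t ord0 i)
         else (fcorner f j)%:R.

Variable X : cubeComplex.

(* the disjoint union of one copy of [0,1]^n for each parametrized n-cube *)
Definition cube_sum : topologicalType :=
  {c : {n : nat & cell X n} & set_type (geometric_cube (tag c))}.

Definition cube_point n (c : cell X n) (t : geometric_cube n) : cube_sum :=
  existT (fun c => set_type (geometric_cube (tag c)))
    (existT (cell X) n c) t.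

Inductive glue : cube_sum -> cube_sum -> Prop :=
| Glue m n (c : cell X n) (f : face_map m n)
    (t : geometric_cube m) (u : geometric_cube n) :
    val u = gapply f (val t) ->
    glue (cube_point (face c f) t) (cube_point c u).

Definition glueb (x y : cube_sum) : bool :=
  `[< clos_refl_sym_trans _ glue x y >].

Lemma glueb_refl : reflexive glueb.
Proof. by move=> p; apply/asboolP; exact: rst_refl. Qed.

Lemma glueb_sym : symmetric glueb.
Proof. by move=> p q; apply/asboolP/asboolP; exact: rst_sym. Qed.

Lemma glueb_trans : transitive glueb.
Proof.
by move=> q p r /asboolP pq /asboolP qr; apply/asboolP; exact: rst_trans qr.
Qed.

Definition glue_rel := EquivRel _ glueb_refl glueb_sym glueb_trans.

(* the topological space underlying X, with the weak (CW) topology *)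
Definition realization := {eq_quot glue_rel}.

HB.instance Definition _ :=
  Topological.copy realization (quotient_topology realization).
HB.instance Definition _ := Quotient.on realization.
HB.instance Definition _ := EqQuotient.on realization.

Definition push (g : cubical_map X X) (x : cube_sum) : cube_sum :=
  let: existT (existT n c) t := x in cube_point (g n c) t.

Definition realize (g : automorphism X) :
    {compact-open, realization -> realization} :=
  fun x => \pi_realization (push g (repr x)).

Lemma realizeE (g : automorphism X) (x : cube_sum) :
  realize g (\pi_realization x) = \pi_realization (push g x).
Proof.
apply/eqmodP/asboolP.
have /eqmodP/asboolP := reprK (\pi_realization x).
move: (repr _) => y.
elim=> [_ _ [m n c f t u e]|z|z w _|z w w' _ h _].
- by apply: rst_step; rewrite /= cmap_face; exact: Glue.
- exact: rst_refl.
- exact: rst_sym.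
- exact: rst_trans h.
Qed.

(* Aut(X) with the compact-open topology *)
Definition Aut : topologicalType := initial_topology realize.

End Realization.
Arguments geometric_cube R n : clear implicits.

Definition discrete_space (T : topologicalType) : Prop :=
  forall A : set T, open A.

Section Labeling.
Variables (X : cubeComplex) (L : finType) (inv : L -> L) (l : oedge X -> L).

Definition endpoint (e : oedge X) (v : vertex X) : Prop :=
  v = origin e \/ v = terminus e.

Definition side (c : cell X 2) (e : oedge X) : Prop :=
  exists b i, e = edge_at c b i.

Definition span_square (e f : oedge X) : Prop :=
  (exists! v, endpoint e v /\ endpoint f v) /\
  (exists c, side c e /\ side c f).

Definition admissible : Prop :=
  [/\ (forall e f, parallel e f -> l e = l f) /\
        (forall e, l (redge e) = inv (l e)),
      forall e f, origin e = origin f -> l e = l f -> e = f &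
      forall e1 e2 e1' e2', origin e1 = origin e2 -> origin e1' = origin e2' ->
        l e1 = l e1' -> l e2 = l e2' ->
        (span_square e1 e2 <-> span_square e1' e2')].

Definition commuting_labels (s t : L) : Prop :=
  exists e f, [/\ origin e = origin f, l e = s, l f = t & span_square e f].

Definition invariant_labeling S (p : cubical_map X S) (x0 : vertex X) : Prop :=
  forall a g, deck_action (p := p) (x0 := x0) a g ->
    forall e, l (g _ e) = l e.

End Labeling.

(* Main.v *)
(* By vertex-transitivity S has a single vertex, its oriented edges correspond
   to the labels, and every vertex of X is the origin of exactly one edge of
   each label.

   If all labels [s], [t] with [s <> t], [s <> t^-1] commute, any two letters of
   a word in the edges of S commute up to homotopy, so Gamma is free abelian;
   and an automorphism of X is determined by its values on finitely many
   vertices, which open stars separate, so Aut(X) is discrete.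

   If [s] and [t] do not commute, letting [s^+-1] and [t^+-1] act by two
   noncommuting involutions and the other labels trivially respects squares,
   so Gamma is not abelian.  Moreover the total exponent of [t] is well defined
   on the vertices of X, and it is constant along edges labeled [s^+-1] and
   along those labeled by anything commuting with [s].  Hence exchanging the
   labels [s] and [s^-1] at the vertices of [t]-exponent > N gives another
   labeling of X with the same commutations, and developing it yields a
   nontrivial automorphism that fixes the ball of radius N.  A compact set
   lies in the union of the open stars of the vertices of a ball, so these
   automorphisms tend to the identity. *)

Require Import Defs.
From Stdlib Require Import Relation_Operators.
From mathcomp Require Import all_boot all_order all_algebra.
From mathcomp Require Import all_classical all_reals all_analysis.
From mathcomp Require Import zify ring lra.
From mathcomp.multinomials Require Import freeg.

Set Implicit Arguments.
Unset Strict Implicit.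
Unset Printing Implicit Defensive.

Import Order.TTheory GRing.Theory Num.Theory.

Local Open Scope classical_set_scope.

(** * Faces of cubes and edge paths *)

Lemma face_map_eq m n (f g : face_map m n) :
  fcorner f = fcorner g -> fdir f = fdir g -> f = g.
Proof.
case: f g => [a d h] [a' d' h'] /= ea ed; subst a' d'.
by congr FaceMap; exact: bool_irrelevance.
Qed.

Definition flip n (b : {ffun 'I_n -> bool}) (i : 'I_n) : {ffun 'I_n -> bool} :=
  [ffun j => b j (+) (j == i)].

Lemma flipK n (i : 'I_n) : involutive (fun b => flip b i).
Proof. by move=> b; apply/ffunP => j; rewrite !ffunE -addbA addbb addbF. Qed.

(** Induction on the number of coordinates switched on; it carries a property from the origin along
    the edges of a cube. *)
Lemma corner_ind n (P : {ffun 'I_n -> bool} -> Prop) :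
  P [ffun=> false] ->
  (forall (b : {ffun 'I_n -> bool}) i, ~~ b i -> P b -> P (flip b i)) ->
  forall b, P b.
Proof.
move=> P0 Pflip b; move: {2}#|_| (leqnn #|[pred i | b i]|) => k.
elim: k b => [|k IHk] b.
  rewrite leqn0 => /eqP/card0_eq b0; rewrite (_ : b = [ffun=> false]) //.
  by apply/ffunP => i; rewrite ffunE; exact: b0.
case: (pickP [pred i | b i]) => [i bi|b0 _]; last first.
  by rewrite (_ : b = [ffun=> false]) //; apply/ffunP => i; rewrite ffunE; exact: b0.
rewrite /= in bi; rewrite (cardD1 i) inE /= bi add1n ltnS => bk.
rewrite -[b](flipK i); apply: Pflip; first by rewrite ffunE bi eqxx.
apply: IHk; apply: leq_trans bk; apply/subset_leq_card/fintype.subsetP => j.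
rewrite !inE !ffunE; case: (altP (j =P i)) => [->|_]; first by rewrite bi.
by rewrite addbF.
Qed.

(** Makes the corner [b] the origin of the cube: the link conditions mention only edges at the
    origin. *)
Definition reflect_cube n (b : {ffun 'I_n -> bool}) : face_map n n :=
  FaceMap b (fid_inj n).

Lemma fapply_reflect n (b b' : {ffun 'I_n -> bool}) :
  fapply (reflect_cube b) b' = [ffun i => b i (+) b' i].
Proof.
apply/ffunP => j; rewrite !ffunE; congr addb.
apply/existsP/idP => [[i]|bj]; first by rewrite ffunE => /andP[/eqP->].
by exists j; rewrite ffunE eqxx.
Qed.

Lemma fapply0 m n (f : face_map m n) : fapply f [ffun=> false] = fcorner f.
Proof.
apply/ffunP => j; rewrite !ffunE; case: existsP; last by rewrite addbF.
by case=> i; rewrite ffunE andbF.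
Qed.

Lemma square_face_inj n (i j : 'I_n) :
  i != j -> injectiveb [ffun x : 'I_2 => if x == ord0 then i else j].
Proof.
move=> ij; apply/injectiveP => -[[|[|//]] lx] [[|[|//]] ly]; rewrite !ffunE /=.
- by move=> _; exact: ord_inj.
- by move=> e; rewrite e eqxx in ij.
- by move=> e; rewrite e eqxx in ij.
- by move=> _; exact: ord_inj.
Qed.

Definition square_face n (b : {ffun 'I_n -> bool}) (i j : 'I_n) (ij : i != j) :
  face_map 2 n := FaceMap b (square_face_inj ij).

Lemma fapply_square n (b : {ffun 'I_n -> bool}) (i j : 'I_n) (ij : i != j) d :
  fapply (square_face b ij) d =
  [ffun k => b k (+) ((k == i) && d ord0 || (k == j) && d ord_max)].
Proof.
apply/ffunP => k; rewrite !ffunE /=; congr addb.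
apply/existsP/idP => [[[[|[|//]] lx]]|/orP[]/andP[/eqP-> dk]].
- rewrite ffunE /= => /andP[/eqP <-]; rewrite eqxx.
  by rewrite (_ : Ordinal lx = ord0) ?orbT => [->//|]; exact: ord_inj.
- rewrite ffunE /= => /andP[/eqP <-]; rewrite eqxx.
  by rewrite (_ : Ordinal lx = ord_max) => [->|]; [rewrite orbT|exact: ord_inj].
- by exists ord0; rewrite ffunE /= eqxx dk.
- by exists ord_max; rewrite ffunE /= eqxx dk.
Qed.

Section Faces.
Variable X : cubeComplex.
Implicit Types (e f : oedge X) (v : vertex X).

Lemma vertex_at_face m n (c : cell X n) (f : face_map m n) b :
  vertex_at (face c f) b = vertex_at c (fapply f b).
Proof.
rewrite /vertex_at face_comp; congr face; apply: face_map_eq => //=.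
by apply/ffunP => -[].
Qed.

Lemma edge_at_face m n (c : cell X n) (f : face_map m n) b i :
  edge_at (face c f) b i = edge_at c (fapply f b) (fdir f i).
Proof.
rewrite /edge_at face_comp; congr face; apply: face_map_eq => //=.
by apply/ffunP => x; rewrite !ffunE.
Qed.

Lemma origin_face m n (c : cell X n) (f : face_map m n) :
  origin (face c f) = vertex_at c (fcorner f).
Proof. by rewrite /origin vertex_at_face fapply0. Qed.

Lemma origin_vertex v : origin v = v.
Proof.
rewrite /origin /vertex_at -[RHS]face_id; congr face.
by apply: face_map_eq; apply/ffunP => -[].
Qed.

Lemma origin_edge_at n (c : cell X n) b i :
  origin (edge_at c b i) = vertex_at c b.
Proof. exact: origin_face. Qed.

Lemma terminus_edge_at n (c : cell X n) b i :
  terminus (edge_at c b i) = vertex_at c (flip b i).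
Proof.
rewrite /terminus vertex_at_face; congr vertex_at.
apply/ffunP => j; rewrite !ffunE /=; congr addb.
apply/existsP/eqP => [[k]|->]; first by rewrite ffunE => /andP[/eqP->].
by exists ord0; rewrite !ffunE eqxx.
Qed.

Lemma redge_edge_at n (c : cell X n) b i :
  redge (edge_at c b i) = edge_at c (flip b i) i.
Proof.
rewrite {1}/redge edge_at_face /= ffunE; congr edge_at.
apply/ffunP => j; rewrite !ffunE /=; congr addb.
apply/existsP/eqP => [[k]|->]; first by rewrite ffunE => /andP[/eqP->].
by exists ord0; rewrite !ffunE eqxx.
Qed.

Lemma edge_at_oedge e : edge_at e [ffun=> false] ord0 = e.
Proof.
rewrite /edge_at -[RHS]face_id; congr face.
by apply: face_map_eq => //; apply/ffunP => i; rewrite !ffunE (ord1 i).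
Qed.

Lemma corner_edge_at n (c : cell X n) b i j :
  i != j -> corner (edge_at c b i) (edge_at c b j).
Proof.
move=> ij; exists (face c (square_face b ij)).
by rewrite /sq_bottom /sq_left !edge_at_face fapply0 /= !ffunE.
Qed.

Lemma opposite_edge_at n (c : cell X n) b i j :
  i != j -> opposite (edge_at c b i) (edge_at c (flip b j) i).
Proof.
move=> ij; exists (face c (square_face b ij)).
rewrite /sq_bottom /sq_top !edge_at_face fapply0 /= !ffunE; split=> //.
congr edge_at; apply/ffunP => k; rewrite fapply_square !ffunE /=.
by rewrite !andbF andbT.
Qed.

Lemma reflect_cubeK n (c : cell X n) b :
  face (face c (reflect_cube b)) (reflect_cube b) = c.
Proof.
rewrite face_comp -[RHS]face_id; congr face; apply: face_map_eq => /=.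
  by rewrite fapply_reflect; apply/ffunP => i; rewrite !ffunE addbb.
by apply/ffunP => i; rewrite !ffunE.
Qed.

Lemma edge_at_reflect n (c : cell X n) b i :
  edge_at (face c (reflect_cube b)) [ffun=> false] i = edge_at c b i.
Proof. by rewrite edge_at_face fapply0 /= ffunE. Qed.

Lemma sq_topE (c : cell X 2) :
  sq_top c = edge_at c (flip [ffun=> false] ord_max) ord0.
Proof. by congr edge_at; apply/ffunP => i; rewrite !ffunE. Qed.

Lemma sq_rightE (c : cell X 2) :
  sq_right c = edge_at c (flip [ffun=> false] ord0) ord_max.
Proof. by congr edge_at; apply/ffunP => i; rewrite !ffunE. Qed.

Lemma corner_sym e f : corner e f -> corner f e.
Proof. by case=> c [-> ->]; exact: corner_edge_at. Qed.

Lemma opposite_left_right (c : cell X 2) : opposite (sq_left c) (sq_right c).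
Proof. by rewrite sq_rightE; exact: opposite_edge_at. Qed.

Lemma corner_redge (c : cell X 2) : corner (redge (sq_bottom c)) (sq_right c).
Proof. by rewrite redge_edge_at sq_rightE; exact: corner_edge_at. Qed.

Lemma corner_origin e f : corner e f -> origin e = origin f.
Proof. by case=> c [-> ->]; rewrite !origin_edge_at. Qed.

(** A flip in another direction passes to the opposite side of a square; a flip in direction [i]
    reverses the edge. *)
Lemma label_edge_at (L : Type) (inv : L -> L) (m : oedge X -> L) :
  involutive inv -> (forall e f, opposite e f -> m e = m f) ->
  (forall e, m (redge e) = inv (m e)) ->
  forall n (c : cell X n) b i,
    m (edge_at c b i) = let a := m (edge_at c [ffun=> false] i) in
                        if b i then inv a else a.
Proof.
move=> invK mopp mrev n c b i /=; elim/corner_ind: b => [|b j bj IHb].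
  by rewrite ffunE.
have [eij|ij] := eqVneq i j.
  by subst j; rewrite -redge_edge_at mrev IHb !ffunE eqxx addbT (negbTE bj).
by rewrite -(mopp _ _ (opposite_edge_at c b ij)) IHb !ffunE (negbTE ij) addbF.
Qed.

(** Backtracks and squares generate homotopy, so an action of edges respecting both depends only on
    the homotopy class of a path. *)
Lemma homotopic_foldl (T : Type) (act : T -> oedge X -> T) :
  (forall y e, act (act y e) (redge e) = y) ->
  (forall y c, act (act y (sq_bottom c)) (sq_right c) =
               act (act y (sq_left c)) (sq_top c)) ->
  forall v w (p q : epath v w) y, homotopic p q ->
    foldl act y (val p) = foldl act y (val q).
Proof.
move=> actK actC v w p q y; elim=> {p q} [p q|//|p q _ ->//|p q r _ -> _ ->//].
by case=> [a e b|a c b]; rewrite !foldl_cat /= ?actK ?actC.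
Qed.

Lemma path_ind v0 (P : vertex X -> Prop) :
  simply_connected X -> P v0 -> (forall e, P (origin e) -> P (terminus e)) ->
  forall v, P v.
Proof.
case=> conn _ P0 Pstep v; case: (conn v0 v) => -[p].
elim: p v0 P0 => [|e p IHp] v0 P0 /=; first by move=> /eqP <-.
by case/andP=> /eqP e0; apply/IHp/Pstep; rewrite e0.
Qed.

(** The value at [v] is the fold along any path from [v0] to [v]; two such paths differ by a
    null-homotopic loop. *)
Lemma developing_map (T : Type) (act : T -> oedge X -> T) v0 y0 :
  simply_connected X ->
  (forall y e, act (act y e) (redge e) = y) ->
  (forall y c, act (act y (sq_bottom c)) (sq_right c) =
               act (act y (sq_left c)) (sq_top c)) ->
  exists d : vertex X -> T,
    d v0 = y0 /\ forall e, d (terminus e) = act (d (origin e)) e.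
Proof.
move=> [conn contr] actK actC.
have foldlK (q : seq (oedge X)) y :
    foldl act (foldl act y (rev (map (@redge X) q))) q = y.
  elim: q y => [//|e q IHq] y /=; rewrite rev_cons foldl_rcons.
  by rewrite -{2}(redgeK e) actK IHq.
have pathE v (q r : epath v0 v) : foldl act y0 (val q) = foldl act y0 (val r).
  have := homotopic_foldl actK actC y0 (contr _ (Defs.cat_path q (inv_path r))).
  by rewrite /= foldl_cat => {2}<-; rewrite foldlK.
have q v : epath v0 v := inhabited_witness (conn v0 v).
exists (fun v => foldl act y0 (val (q v))); split=> [|e].
  by rewrite (pathE _ _ (nil_path v0)).
have pe : is_path (origin e) [:: e] (terminus e) by rewrite /= !eqxx.
pose r : epath (origin e) (terminus e) := exist _ [:: e] pe.
by rewrite (pathE _ _ (Defs.cat_path (q (origin e)) r)) /= foldl_cat.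
Qed.

End Faces.

Section CubicalMaps.
Variables (X Y : cubeComplex) (g : cubical_map X Y).

Lemma cmap_edge_at n (c : cell X n) b i :
  g _ (edge_at c b i) = edge_at (g _ c) b i.
Proof. exact: cmap_face. Qed.

Lemma cmap_origin n (c : cell X n) : g _ (origin c) = origin (g _ c).
Proof. exact: cmap_face. Qed.

Lemma cmap_terminus e : g _ (terminus e) = terminus (g _ e).
Proof. exact: cmap_face. Qed.

Lemma cmap_redge e : g _ (redge e) = redge (g _ e).
Proof. exact: cmap_face. Qed.

Lemma cmap_corner e f : corner e f -> corner (g _ e) (g _ f).
Proof. by case=> c [-> ->]; exists (g _ c); split; exact: cmap_edge_at. Qed.

End CubicalMaps.

(** * Admissible labelings *)

Lemma cell_eq (X : cubeComplex) n (c c' : cell X n) :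
  nonpositively_curved X -> origin c = origin c' ->
  (forall i, edge_at c [ffun=> false] i = edge_at c' [ffun=> false] i) ->
  c = c'.
Proof.
move=> [_ npc] oc ec.
have [|i j ij|c0 [_ uniq_c0]] :=
  npc (origin c) n (edge_at c [ffun=> false]).
- by move=> i; rewrite origin_edge_at.
- exact: corner_edge_at.
by transitivity c0; [apply/esym|]; apply: uniq_c0; split=> // i; rewrite ec.
Qed.

Lemma edge_at_inj (X : cubeComplex) n (c : cell X n) b :
  nonpositively_curved X -> injective (edge_at c b).
Proof.
case=> npc _ i j ij; apply: (npc n (face c (reflect_cube b))).
by rewrite !edge_at_reflect.
Qed.

Section Labelled.
Variables (X : cubeComplex) (Sigma0 : finType) (inv : Sigma0 -> Sigma0).
Variable l : oedge X -> Sigma0.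
Hypothesis X_sc : simply_connected X.
Hypothesis X_npc : nonpositively_curved X.
Hypothesis invK : involutive inv.
Hypothesis inv_neq : forall s, inv s <> s.
Hypothesis l_adm : admissible inv l.
Hypothesis l_total : forall v s, exists e, origin e = v /\ l e = s.
Implicit Types (e f : oedge X) (v : vertex X) (s t : Sigma0).

Let l_opp e f : opposite e f -> l e = l f.
Proof. by case: l_adm => -[lpar _] _ _ ef; apply/lpar/rst_step. Qed.

Let l_redge e : l (redge e) = inv (l e).
Proof. by case: l_adm => -[_ ->]. Qed.

Let l_inj e f : origin e = origin f -> l e = l f -> e = f.
Proof. by case: l_adm => _ linj _; exact: linj. Qed.

(** By (A2) equal labels would force [e = f], but under nonpositive curvature the edges at a corner
    are distinct. *)
Lemma corner_label e f : corner e f -> l e <> l f.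
Proof.
move=> ef lef; have := l_inj (corner_origin ef) lef.
by case: ef => c [-> ->] /(edge_at_inj X_npc).
Qed.

(** Sliding [f] across the square and reversing [e] gives the neighboring corner, to which
    [corner_label] applies. *)
Lemma corner_label_inv e f : corner e f -> l e <> inv (l f).
Proof.
case=> c [-> ->]; rewrite (l_opp (opposite_left_right c)) => h.
by apply: (corner_label (corner_redge c)); rewrite l_redge h invK.
Qed.

(** The contribution of a letter [b] to the total exponent of [a] in a word. *)
Definition exponent (a b : Sigma0) : int := ((b == a)%:Z - (b == inv a)%:Z)%R.

Lemma exponent_inv a b : exponent a (inv b) = (- exponent a b)%R.
Proof.
by rewrite /exponent (can2_eq invK invK) (inj_eq (inv_inj invK)) opprB.
Qed.

Lemma exponent1 a : exponent a a = 1%R.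
Proof. by rewrite /exponent eqxx; case: eqP => // /esym /inv_neq. Qed.

Lemma exponent0 a b : b <> a -> b <> inv a -> exponent a b = 0%R.
Proof. by rewrite /exponent => /eqP/negbTE-> /eqP/negbTE->. Qed.

Lemma exponent_sum v0 a :
  exists d : vertex X -> int, d v0 = 0%R /\
    forall e, d (terminus e) = (d (origin e) + exponent a (l e))%R.
Proof.
apply: (developing_map (act := fun z e => (z + exponent a (l e))%R)) => //.
  by move=> y e; rewrite l_redge exponent_inv addrK.
move=> y c; rewrite -(l_opp (opposite_left_right c)).
rewrite -[l (sq_top c)](l_opp (e := sq_bottom c)); last by exists c.
by rewrite addrAC.
Qed.

(** The exponent of the label in direction [i] reads off the [i]-th coordinate of a corner, because
    the other directions carry neither that label nor its inverse. *)
Lemma vertex_at_inj n (c : cell X n) : injective (vertex_at c).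
Proof.
move=> b b' bb'; apply/ffunP => i.
have [d [_ dE]] := exponent_sum (origin c) (l (edge_at c [ffun=> false] i)).
suff dc a : d (vertex_at c a) = (d (origin c) + (a i)%:Z)%R.
  have := dc b; rewrite bb' dc => /addrI.
  by case: (b i) (b' i) => -[].
elim/corner_ind: a => [|a j aj IHa]; first by rewrite ffunE addr0.
rewrite -terminus_edge_at dE origin_edge_at IHa.
rewrite (label_edge_at invK l_opp l_redge c a) (negbTE aj) /= ffunE.
have [->|ij] := eqVneq i j; first by rewrite exponent1 (negbTE aj) addr0.
have ji : j != i by rewrite eq_sym.
rewrite exponent0 ?addbF ?addr0 //.
- exact/corner_label/corner_edge_at.
- exact/corner_label_inv/corner_edge_at.
Qed.

Lemma terminus_neq e : terminus e <> origin e.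
Proof.
rewrite -(edge_at_oedge e) terminus_edge_at origin_edge_at => /vertex_at_inj.
by move/ffunP/(_ ord0); rewrite !ffunE eqxx.
Qed.

Lemma corner_span e f : corner e f -> span_square e f.
Proof.
move=> ef; split; last first.
  by case: ef => c [-> ->]; exists c; split; eexists; eexists; reflexivity.
have oef := corner_origin ef.
exists (origin e); split; first by split; [left|left].
move=> v [[->//|ve] [->//|vf]]; move: vf; rewrite ve => {v ve}.
case: ef => c [-> ->]; rewrite !terminus_edge_at => /vertex_at_inj.
by move/ffunP/(_ ord0); rewrite !ffunE.
Qed.

(** Cubes are embedded, so a common origin is one corner of the square. The two directions there
    differ, since equal edges would share both endpoints. *)
Lemma span_corner e f : origin e = origin f -> span_square e f -> corner e f.
Proof.
move=> oef [[v [_ uniq_v]] [c [[b [i ec]] [b' [j fc]]]]].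
move: oef; rewrite ec fc !origin_edge_at => /vertex_at_inj bb'; subst b'.
have [eij|] := eqVneq i j; last exact: corner_edge_at.
have ef : e = f by rewrite ec fc eij.
case: (@terminus_neq e); rewrite -(uniq_v (origin e)).
  by rewrite -(uniq_v (terminus e)) //; split; [right|rewrite -ef; right].
by split; [left|rewrite -ef; left].
Qed.

(** By (A3), one square with the two labels at some vertex yields such a square wherever the two
    labels meet. *)
Lemma commuting_corner e f :
  origin e = origin f -> (commuting_labels l (l e) (l f) <-> corner e f).
Proof.
move=> oef; split=> [[e' [f' [oef' le lf sp]]]|ef].
  case: l_adm => _ _ l_span; apply: span_corner => //.
  exact/(l_span e' f').
by exists e, f; split=> //; exact: corner_span.
Qed.

Lemma commuting_corner_ex s t v : commuting_labels l s t ->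
  exists e f, [/\ origin e = v, l e = s, l f = t & corner e f].
Proof.
move=> st; have [[e [oe le]] [f [of_ lf]]] := (l_total v s, l_total v t).
exists e, f; split=> //; apply/commuting_corner; first by rewrite oe.
by rewrite le lf.
Qed.

Lemma corner_commuting e f : corner e f -> commuting_labels l (l e) (l f).
Proof. by move=> ef; apply/commuting_corner => //; exact: corner_origin. Qed.

Lemma commuting_sym s t : commuting_labels l s t -> commuting_labels l t s.
Proof.
case=> e [f [oef <- <- sp]]; apply: corner_commuting.
by apply: corner_sym; exact: span_corner.
Qed.

Lemma commuting_invl s t :
  commuting_labels l s t -> commuting_labels l (inv s) t.
Proof.
case=> e [f [oef <- <- /(span_corner oef)[c [-> ->]]]].
rewrite -l_redge (l_opp (opposite_left_right c)).
exact/corner_commuting/corner_redge.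
Qed.

Lemma commuting_invr s t :
  commuting_labels l s t -> commuting_labels l s (inv t).
Proof. by move/commuting_sym/commuting_invl/commuting_sym. Qed.

(** By (A2) fixed vertices propagate along paths, and a cell is determined by its origin and the
    edges there. *)
Lemma label_rigid (h : cubical_map X X) v0 :
  h _ v0 = v0 -> (forall e, l (h _ e) = l e) -> forall n (c : cell X n), h _ c = c.
Proof.
move=> h0 hl.
have hE e : h _ (origin e) = origin e -> h _ e = e.
  by move=> he; apply: l_inj => //; rewrite -cmap_origin.
have hV v : h _ v = v.
  elim/(path_ind (v0 := v0)): v => // e /hE he.
  by rewrite cmap_terminus he.
move=> n c; apply: cell_eq => //; first by rewrite -cmap_origin hV.
by move=> i; rewrite -cmap_edge_at hE // origin_edge_at hV.
Qed.

(* [m] is a second labeling of the edges of X; the map sends a path from [v0]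
   to the path from [v0] whose [l]-labels are the [m]-labels of the former. *)
Lemma relabel_map (m : oedge X -> Sigma0) v0 :
  (forall e f, opposite e f -> m e = m f) ->
  (forall e, m (redge e) = inv (m e)) ->
  (forall e f, corner e f -> commuting_labels l (m e) (m f)) ->
  exists h : cubical_map X X, h _ v0 = v0 /\ forall e, l (h _ e) = m e.
Proof.
move=> m_opp m_redge m_comm.
pose E v a := sval (cid (l_total v a)).
have oE v a : origin (E v a) = v by rewrite /E; case: cid => e [].
have lE v a : l (E v a) = a by rewrite /E; case: cid => e [].
have EP e v a : origin e = v -> l e = a -> e = E v a.
  by move=> oe le; apply: l_inj; rewrite ?oE ?lE.
have [|y c|hV [hV0 hVE]] := developing_map
    (act := fun y e => terminus (E y (m e))) v0 v0 X_sc.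
- move=> y e; rewrite -(EP (redge (E y (m e)))) ?terminus_redge //.
    by rewrite origin_redge.
  by rewrite l_redge lE m_redge.
(* The [m]-labels of adjacent sides commute, so a square [c'] at [y] carries them. The two routes
   around [c] develop to the two routes around [c'], which meet at its far corner. *)
- have bl : corner (sq_bottom c) (sq_left c) by exists c.
  have := commuting_corner_ex y (m_comm _ _ bl).
  case=> e' [f' [oc' lb ll [c' [? ?]]]]; subst e' f'.
  rewrite -(m_opp _ _ (opposite_left_right c)).
  rewrite -(m_opp (sq_bottom c) (sq_top c)); last by exists c.
  have ol : origin (sq_left c') = y by rewrite -oc' !origin_edge_at.
  rewrite -(EP _ _ _ oc' lb) -(EP _ _ _ ol ll).
  rewrite -(EP (sq_right c')); first last.
  + by rewrite -ll -(l_opp (opposite_left_right c')).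
  + by rewrite sq_rightE origin_edge_at terminus_edge_at.
  rewrite -(EP (sq_top c')); first last.
  + by rewrite -lb; apply/esym/l_opp; exists c'.
  + by rewrite sq_topE origin_edge_at terminus_edge_at.
  rewrite sq_rightE sq_topE !terminus_edge_at; congr vertex_at.
  by apply/ffunP => i; rewrite !ffunE /= addbC.
pose hE e := E (hV (origin e)) (m e).
(* The images of the edges at the origin of [c] have pairwise commuting labels, so by flagness they
   span a cube. *)
have ex_h n (c : cell X n) : exists c' : cell X n, origin c' = hV (origin c) /\
    forall i, edge_at c' [ffun=> false] i = hE (edge_at c [ffun=> false] i).
  have [|i j ij|c' [hc' _]] := X_npc.2 (hV (origin c)) n
      (fun i => hE (edge_at c [ffun=> false] i)); last by exists c'.
  - by move=> i; rewrite oE origin_edge_at.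
  - apply/commuting_corner; first by rewrite !oE !origin_edge_at.
    by rewrite !lE; apply/m_comm/corner_edge_at.
pose h n c := sval (cid (ex_h n c)).
have oh n c : origin (h n c) = hV (origin c).
  by rewrite /h; case: cid => c' [].
have eh n c i : edge_at (h n c) [ffun=> false] i = hE (edge_at c [ffun=> false] i).
  by rewrite /h; case: cid => c' [].
have edge_h n (c : cell X n) b i : vertex_at (h n c) b = hV (vertex_at c b) ->
    edge_at (h n c) b i = hE (edge_at c b i).
  move=> hcb; apply: EP; first by rewrite !origin_edge_at.
  rewrite (label_edge_at invK l_opp l_redge) /= eh lE.
  by rewrite [RHS](label_edge_at invK m_opp m_redge).
have vertex_h n (c : cell X n) b : vertex_at (h n c) b = hV (vertex_at c b).
  elim/corner_ind: b => [|b i _ IHb]; first exact: oh.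
  rewrite -terminus_edge_at edge_h // -terminus_edge_at hVE.
  by rewrite /hE origin_edge_at.
have face_h k n (c : cell X n) (f : face_map k n) : h k (face c f) = face (h n c) f.
  apply: cell_eq => [//||i]; first by rewrite oh !origin_face vertex_h.
  by rewrite eh !edge_at_face edge_h.
exists (CubicalMap face_h); split=> [|e] /=.
  by rewrite -[LHS]origin_vertex oh origin_vertex.
by rewrite -[h _ e]edge_at_oedge eh lE edge_at_oedge.
Qed.

End Labelled.

(** * Swapping a label far away *)

Fixpoint ball (X : cubeComplex) (v0 : vertex X) (k : nat) (v : vertex X) : Prop :=
  if k is k'.+1 then
    ball v0 k' v \/ exists e, ball v0 k' (origin e) /\ terminus e = v
  else v = v0.

Lemma ball_exhaust (X : cubeComplex) (v0 v : vertex X) :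
  simply_connected X -> exists k, ball v0 k v.
Proof.
move=> X_sc; elim/(path_ind (v0 := v0)): v => //; first by exists 0%N.
by move=> e [k ek]; exists k.+1; right; exists e.
Qed.

Lemma ball_le (X : cubeComplex) (v0 v : vertex X) j k :
  (j <= k)%N -> ball v0 j v -> ball v0 k v.
Proof. by move=> /subnK <-; elim: (k - j)%N => //= i IHi /IHi; left. Qed.

Lemma cubical_map_comp_face (X : cubeComplex) (g h : cubical_map X X) k n
    (c : cell X n) (f : face_map k n) :
  g _ (h _ (face c f)) = face (g _ (h _ c)) f.
Proof. by rewrite !cmap_face. Qed.

Section Swap.
Variables (X : cubeComplex) (Sigma0 : finType) (inv : Sigma0 -> Sigma0).
Variable l : oedge X -> Sigma0.
Hypothesis X_sc : simply_connected X.
Hypothesis X_npc : nonpositively_curved X.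
Hypothesis invK : involutive inv.
Hypothesis inv_neq : forall s, inv s <> s.
Hypothesis l_adm : admissible inv l.
Hypothesis l_total : forall v s, exists e, origin e = v /\ l e = s.
Implicit Types (e f : oedge X) (v : vertex X).

Let l_opp e f : opposite e f -> l e = l f.
Proof. by case: l_adm => -[lpar _] _ _ ef; apply/lpar/rst_step. Qed.

Let l_redge e : l (redge e) = inv (l e).
Proof. by case: l_adm => -[_ ->]. Qed.

Let l_inj e f : origin e = origin f -> l e = l f -> e = f.
Proof. by case: l_adm => _ linj _; exact: linj. Qed.

(* Exchange [s] and [s^-1] on the edges issued from the vertices whose
   [t]-exponent exceeds [N].  Neither an edge labeled [s] nor one whose label
   commutes with [s] changes the [t]-exponent, so this is a legitimate
   labeling, and it differs from [l] only far away from [v0]. *)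
Lemma swap_automorphism v0 (s t : Sigma0) N :
  s <> t -> s <> inv t -> ~ commuting_labels l s t ->
  exists g : automorphism X, (exists e, g _ e <> e) /\
    forall n (c : cell X n) b, ball v0 N (vertex_at c b) -> g _ c = c.
Proof.
move=> st sit nst.
have comm_invl a b := @commuting_invl _ _ _ _ X_sc X_npc invK inv_neq l_adm a b.
have comm_invr a b := @commuting_invr _ _ _ _ X_sc X_npc invK inv_neq l_adm a b.
have [d [d0 dE]] := exponent_sum X_sc invK l_adm v0 t.
pose sw a := if (a == s) || (a == inv s) then inv a else a.
have swK a : sw (sw a) = a.
  rewrite /sw; have [sa|/negbTE nsa] := boolP ((a == s) || (a == inv s)).
    by case/orP: sa => /eqP ->; rewrite ?invK eqxx ?orbT.
  by rewrite nsa.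
have sw_inv a : sw (inv a) = inv (sw a).
  by rewrite /sw (can2_eq invK invK) (inj_eq (inv_inj invK)) orbC; case: ifP.
have s_exp a : (a == s) || (a == inv s) -> exponent inv t a = 0%R.
  by case/orP => /eqP ->; rewrite ?exponent_inv // exponent0.
have sw_exp a : exponent inv t (sw a) = exponent inv t a.
  rewrite /sw; case: ifP => // /s_exp a0.
  by rewrite exponent_inv // a0.
(* A label commuting with [s] or [inv s] is neither [t] nor [inv t]; hence crossing a square with a
   side labeled [s] does not change the [t]-exponent. *)
have comm_exp a b : (a == s) || (a == inv s) -> commuting_labels l a b ->
    exponent inv t b = 0%R.
  move=> sa ab; have sb : commuting_labels l s b.
    case/orP: sa ab => /eqP-> // /comm_invl; rewrite invK; exact.
  rewrite exponent0 // => eb; apply: nst; rewrite eb in sb => //.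
  by move/comm_invr: sb; rewrite invK.
pose far v := (N%:Z < d v)%R.
pose m e := if far (origin e) then sw (l e) else l e.
have m_opp e f : opposite e f -> m e = m f.
  case=> c [-> ->]; rewrite /m -(l_opp (e := sq_bottom c)); last by exists c.
  rewrite sq_topE !origin_edge_at -terminus_edge_at /far dE !origin_edge_at.
  have [sl|nsl] := boolP ((l (sq_bottom c) == s) || (l (sq_bottom c) == inv s)).
    by rewrite (comm_exp _ _ sl) ?addr0 //; apply: corner_commuting => //; exists c.
  by rewrite /sw (negbTE nsl) !if_same.
have m_redge e : m (redge e) = inv (m e).
  rewrite /m l_redge origin_redge /far dE sw_inv.
  have [sl|nsl] := boolP ((l e == s) || (l e == inv s)).
    by rewrite s_exp // addr0; case: ifP.
  by rewrite /sw (negbTE nsl) !if_same.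
have m_corner e f : corner e f -> commuting_labels l (m e) (m f).
  move=> ef; rewrite /m (corner_origin ef).
  have := corner_commuting X_sc X_npc invK inv_neq l_adm ef.
  case: (far _) => // cf; rewrite /sw.
  case: ifP => _; first apply: comm_invl => //;
    by case: ifP => _ //; apply: comm_invr.
have [h [h0 hl]] :=
  relabel_map X_sc X_npc invK inv_neq l_adm l_total v0 m_opp m_redge m_corner.
(* [sw] preserves [t]-exponents, so [h] preserves [d] and the set of far vertices. Applying [h]
   twice therefore restores all labels, which makes [h] an involution. *)
have dh v : d (h _ v) = d v.
  elim/(path_ind (v0 := v0)): v => //; first by rewrite h0.
  move=> e IHe; rewrite cmap_terminus !dE -cmap_origin IHe hl /m.
  by case: ifP; rewrite ?sw_exp.
have hK n : involutive (@h n).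
  move=> c; have := label_rigid X_sc X_npc l_adm
    (h := CubicalMap (@cubical_map_comp_face X h h)) (v0 := v0); apply=> [|e] /=.
    by rewrite !h0.
  rewrite hl /m -cmap_origin /far dh hl /m /far.
  by case: (_ < d _)%R; rewrite ?swK.
exists (Automorphism (fun n => inv_bij (hK n))); split=> /=.
  (* A vertex reached from [v0] by [N.+1] edges labeled [t] is far, so its edge labeled [s] goes to
     one labeled [inv s]. *)
  have [v dv] : exists v, d v = Posz N.+1.
    elim: N.+1 => [|k [v dv]]; first by exists v0.
    have [e [oe le]] := l_total v t; exists (terminus e).
    by rewrite dE oe dv le exponent1 // -addn1 PoszD.
  have [e [oe le]] := l_total v s; exists e => he.
  have := hl e; rewrite he le /m /far oe dv ltz_nat ltnSn /sw le eqxx /=.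
  by move/esym/inv_neq.
(* Each edge changes [d] by at most one, so no vertex of the ball of radius [N] is far. *)
have d_ball k v : ball v0 k v -> (d v <= k%:Z)%R.
  elim: k v => [|k IHk] v /=; first by move=> ->; rewrite d0.
  have k1 : (k%:Z <= k.+1%:Z)%R by rewrite lez_nat.
  case=> [/IHk dk|[e [/IHk dk <-]]]; first exact: le_trans k1.
  rewrite dE -[k.+1]addn1 PoszD; apply: lerD => //; rewrite /exponent.
  by case: (_ == _) => //; case: (_ == _).
have m_near e : ball v0 N (origin e) -> m e = l e.
  by move=> /d_ball dN; rewrite /m /far ltNge dN.
have h_edge e : ball v0 N (origin e) -> h _ (origin e) = origin e -> h _ e = e.
  move=> eN he; apply: l_inj; first by rewrite -cmap_origin.
  by rewrite hl m_near.
have h_ball k v : (k <= N)%N -> ball v0 k v -> h _ v = v.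
  elim: k v => [|k IHk] v /= kN; first by move=> ->.
  have kN' := ltnW kN.
  case=> [/(IHk _ kN')//|[e [ek <-]]]; rewrite cmap_terminus h_edge //.
    exact: ball_le ek.
  exact: IHk.
move=> n c b cN; rewrite -(reflect_cubeK c b) cmap_face; congr face.
apply: cell_eq => // [|i].
  by rewrite -cmap_origin origin_face (h_ball N).
rewrite -cmap_edge_at edge_at_reflect h_edge ?origin_edge_at //.
exact: (h_ball N).
Qed.

End Swap.

(** * The topology of Aut(X) *)

Section Gluing.
Local Open Scope ring_scope.
Variables (R : realType) (m n : nat) (f : face_map m n).

Lemma gapply_dir (t : 'rV[R]_m) i :
  gapply f t ord0 (fdir f i) =
  if fcorner f (fdir f i) then 1 - t ord0 i else t ord0 i.
Proof.
rewrite mxE; case: pickP => [j /eqP ji|/(_ i)]; last by rewrite eqxx.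
by rewrite ((injectiveP _ (fdir_inj f)) _ _ ji).
Qed.

Lemma gapply_off (t : 'rV[R]_m) j :
  (forall i, fdir f i != j) -> gapply f t ord0 j = (fcorner f j)%:R.
Proof. by move=> nj; rewrite mxE; case: pickP => // i; rewrite (negbTE (nj i)). Qed.

Lemma fapply_dir b i : fapply f b (fdir f i) = fcorner f (fdir f i) (+) b i.
Proof.
rewrite ffunE; congr addb; apply/existsP/idP => [[j /andP[/eqP ji]]|bi].
  by rewrite ((injectiveP _ (fdir_inj f)) _ _ ji).
by exists i; rewrite eqxx.
Qed.

Lemma fapply_off b j : (forall i, fdir f i != j) -> fapply f b j = fcorner f j.
Proof.
move=> nj; rewrite ffunE; case: existsP; last by rewrite addbF.
by case=> i; rewrite (negbTE (nj i)).
Qed.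

Lemma gapply_corner (t : 'rV[R]_m) b i :
  (gapply f t ord0 (fdir f i) = (~~ fapply f b (fdir f i))%:R) <->
  (t ord0 i = (~~ b i)%:R).
Proof.
rewrite gapply_dir fapply_dir; case: (fcorner f _) => //=; rewrite negbK.
by case: (b i) => /=; split; lra.
Qed.

End Gluing.

Section Star.
Local Open Scope quotient_scope.
Variables (R : realType) (X : cubeComplex).
Implicit Types P : vertex X -> Prop.

(* the union of the open stars of the vertices satisfying [P] *)
Definition star P (z : cube_sum R X) : Prop :=
  let: existT (existT n c) t := z in
  exists b : {ffun 'I_n -> bool},
    P (vertex_at c b) /\ forall i, val t ord0 i <> ((~~ b i)%:R)%R.

(** A point of a face lies in the open star of a corner of the larger cube only if that corner is in
    the face, and then the coordinates off the face add no condition. *)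
Lemma star_glue P (z z' : cube_sum R X) : Defs.glue z z' -> (star P z <-> star P z').
Proof.
case=> m n c f t u e /=; split=> [[b [Pb tb]]|[b' [Pb' ub']]].
  exists (fapply f b); rewrite -vertex_at_face; split=> // j; rewrite e.
  have [/existsP[i /eqP <-]|] := boolP [exists i, fdir f i == j].
    by rewrite gapply_corner; exact: tb.
  rewrite negb_exists => /forallP nj; rewrite gapply_off // fapply_off //.
  by case: (fcorner f j) => /eqP; rewrite ?oner_eq0 // eq_sym oner_eq0.
pose b : {ffun 'I_m -> bool} := [ffun i => fcorner f (fdir f i) (+) b' (fdir f i)].
have fb : fapply f b = b'.
  apply/ffunP => j; have [/existsP[i /eqP <-]|] := boolP [exists i, fdir f i == j].
    by rewrite fapply_dir ffunE addbA addbb.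
  rewrite negb_exists => /forallP nj; rewrite fapply_off //.
  have := ub' j; rewrite e gapply_off //.
  by case: (fcorner f j) (b' j) => -[].
exists b; rewrite vertex_at_face fb; split=> // i ti.
by apply: (ub' (fdir f i)); rewrite e -fb gapply_corner.
Qed.

Lemma star_pi P (z : cube_sum R X) :
  star P (repr (\pi_(realization R X) z)) <-> star P z.
Proof.
have /eqmodP/asboolP := reprK (\pi_(realization R X) z).
move: (repr _) => y; elim=> [x x'|//|x x' _|x x' x'' _ h1 _ h2].
- exact: star_glue.
- by move=> ->.
- by rewrite h1.
Qed.

Lemma open_star P : open [set z : realization R X | star P (repr z)].
Proof.
rewrite /open /= /quotient_open.
rewrite (_ : _ @^-1` _ = [set z | star P z]); last first.
  by apply/seteqP; split=> z /=; rewrite star_pi.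
apply/sigT_openP => -[n c] /=.
exists (\bigcup_(b in [set b : {ffun 'I_n -> bool} | P (vertex_at c b)])
   [set u : 'rV[R]_n | forall i, u ord0 i <> ((~~ b i)%:R)%R]); last first.
  apply/seteqP; split=> t /=; first by case=> b Pb tb; exists b.
  by case=> b [Pb tb]; exists b.
apply: bigcup_open => b _; rewrite openE => u ub.
apply: (@filter_forall _ _
  (fun i (u : 'rV[R]_n) => u ord0 i <> ((~~ b i)%:R)%R) (nbhs u)) => i.
have nb : nbhs (u ord0 i) [set x | x != ((~~ b i)%:R)%R].
  by apply: open_nbhs_nbhs; split; [exact: open_neq | exact/eqP/ub].
refine (@filterS _ (nbhs u) (nbhs_filter u) _ _ _ (@coord_continuous R 1 n ord0 i u _ nb)).
by move=> w /eqP.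
Qed.

Lemma star_exhaust v0 (z : cube_sum R X) :
  simply_connected X -> exists k, star (ball v0 k) z.
Proof.
case: z => -[n c] t X_sc.
(* Rounding every nonzero coordinate up to 1 gives a corner whose open star contains the point. *)
pose b : {ffun 'I_n -> bool} := [ffun i => val t ord0 i != 0%R].
have [k bk] := ball_exhaust v0 (vertex_at c b) X_sc.
exists k, b; split=> // i; rewrite ffunE negbK.
by case: eqP => [->/esym/eqP|//]; rewrite oner_eq0.
Qed.

Lemma realize_fix P (h : automorphism X) (x : realization R X) :
  (forall n (c : cell X n) b, P (vertex_at c b) -> h _ c = c) ->
  star P (repr x) -> realize h x = x.
Proof.
move=> hP; rewrite -{2 3}[x]reprK realizeE.
by case: (repr x) => -[n c] t /= [b [/hP hb _]]; rewrite hb.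
Qed.

Lemma id_face k n (c : cell X n) (f : face_map k n) : id (face c f) = face (id c) f.
Proof. by []. Qed.

Definition id_automorphism : automorphism X :=
  @Automorphism X (CubicalMap id_face) (fun n => inv_bij (fun x => erefl)).

Lemma automorphism_eq (g h : automorphism X) :
  (forall n (c : cell X n), g _ c = h _ c) -> g = h.
Proof.
case: g h => [[g g_face] g_bij] [[h h_face] h_bij] /= gh.
have e : g = h by apply: functional_extensionality_dep => n; exact/funext.
subst h; rewrite (Prop_irrelevance h_face g_face) in h_bij *.
by rewrite (Prop_irrelevance h_bij g_bij).
Qed.

(** The [g N] converge to the identity in the compact-open topology, yet each moves an edge, so the
    identity is not isolated. *)
Lemma aut_not_discrete v0 :
  simply_connected X ->
  (forall N, exists g : automorphism X, (exists e : oedge X, g _ e <> e) /\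
    forall n (c : cell X n) b, ball v0 N (vertex_at c b) -> g _ c = c) ->
  ~ discrete_space (Aut R X).
Proof.
move=> X_sc /choice[g gP] /(_ [set id_automorphism])[W oW Wid].
have Wg : \forall N \near \oo, W (realize (g N)).
  apply: (_ : (@realize R X \o g) @ \oo --> realize id_automorphism); last first.
    by apply: open_nbhs_nbhs; split=> //; rewrite -[_ _]/((_ @^-1` W) _) Wid.
  apply/compact_open_cvgP => K O /compact_near_coveringP cK oO KO.
  (* The stars of the balls are open, increasing and exhaust the space, so one of them contains the
     compact set [K]. *)
  have /cK : forall x, K x ->
      \forall x' \near x & N \near \oo, star (ball v0 N) (repr x').
    move=> x Kx; have [k xk] := star_exhaust v0 (repr x) X_sc.
    exists ([set z | star (ball v0 k) (repr z)], [set N | (k <= N)%N]) => /=.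
      split; last exact: nbhs_infty_ge.
      by apply: open_nbhs_nbhs; split=> //; exact: open_star.
    case=> y N [/= + kN]; case: (repr y) => -[n c] t [b [yb tb]].
    by exists b; split=> //; exact: ball_le yb.
  apply: filterS => N KN _ [x Kx <-]; apply: KO; exists x => //.
  have -> : realize id_automorphism x = x by apply: (@realize_fix (ball v0 N)) => //; exact: KN.
  by apply/esym/(@realize_fix (ball v0 N)); [exact: (gP N).2 | exact: KN].
have [N WN] := filter_ex Wg.
have gid : g N = id_automorphism.
  by have : (@realize R X @^-1` W) (g N) by []; rewrite Wid.
by have [[e]] := gP N; rewrite gid.
Qed.

(** The open star of [g v] contains no other vertex, so sending [v] into it is an open condition
    that forces agreement with [g] at [v]. Finitely many such conditions isolate [g]. *)
Lemma aut_discrete (A : seq (vertex X)) :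
  (forall g h : automorphism X, {in A, forall v, g _ v = h _ v} -> g = h) ->
  discrete_space (Aut R X).
Proof.
move=> rigid B; rewrite openE => g Bg.
have cube0 : geometric_cube R 0 0%R by case.
pose pt v : realization R X :=
  \pi_(realization R X) (cube_point (v : cell X 0) (exist _ 0%R (mem_set cube0))).
have pt_star v w : star (eq^~ w) (repr (pt v)) -> v = w.
  rewrite star_pi => -[b [<- _]].
  rewrite -[LHS]origin_vertex /origin; congr vertex_at; by apply/ffunP => -[].
pose T v : set (Aut R X) :=
  [set h : Aut R X | star (eq^~ (g _ v)) (repr (realize (h : automorphism X) (pt v)))].
have gT v : nbhs (g : Aut R X) (T v).
  apply: open_nbhs_nbhs; split; last first.
    rewrite /T /= realizeE; apply/star_pi.
    by exists [ffun=> false]; split=> [|[]//]; rewrite -/(origin _) origin_vertex.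
  pose U := [set f : {compact-open, realization R X -> realization R X} |
    f @` [set pt v] `<=` [set z | star (eq^~ (g _ v)) (repr z)]].
  have oU : open U.
    by apply: compact_open_open; [exact: compact_set1 | exact: open_star].
  exists U => //; apply/seteqP; split=> h /=; first by apply; exists (pt v).
  by move=> hv _ [_ -> <-].
have : nbhs (g : Aut R X) [set h | {in A, forall v, T v h}].
  elim: A {rigid} => [|v A IHA].
    by rewrite (_ : mkset _ = setT) ?predeqE //; exact: filterT.
  apply: (filterS _ (filterI (gT v) IHA)) => h [hv hA] w.
  by rewrite inE => /orP[/eqP->|/hA].
apply: filterS => h hA; rewrite -(rigid g h) // => v /hA.
by rewrite /T /= realizeE => /pt_star.
Qed.

End Star.

(** * The commuting case *)

Section Coverings.
Variables (X S : cubeComplex) (p : cubical_map X S).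
Hypothesis p_covering : covering p.
Implicit Types e f : oedge X.

Lemma lift_eq n (c c' : cell X n) : origin c = origin c' -> p _ c = p _ c' -> c = c'.
Proof.
move=> oc pc; have [|c0 [_ uniq]] := p_covering.2 (origin c) n (p _ c).
  by rewrite cmap_origin.
by transitivity c0; [apply/esym|]; apply: uniq.
Qed.

Lemma lift_corner e f :
  origin e = origin f -> corner (p _ e) (p _ f) -> corner e f.
Proof.
move=> oef [c [ec fc]]; have [|c' [[oc' pc'] _]] := p_covering.2 (origin e) 2 c.
  by rewrite cmap_origin ec origin_edge_at.
exists c'; split; apply: lift_eq.
- by rewrite origin_edge_at.
- by rewrite ec cmap_edge_at pc'.
- by rewrite origin_edge_at -oef.
- by rewrite fc cmap_edge_at pc'.
Qed.

Lemma nonpositively_curved_cover : nonpositively_curved S -> nonpositively_curved X.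
Proof.
move=> [npc1 npc2]; split=> [n c i j ij|v n e oe ce].
  by apply: (npc1 n (p _ c)); rewrite -!cmap_edge_at ij.
have [i|i j ij|cS [[ocS ecS] uniq_cS]] := npc2 (p _ v) n (fun i => p _ (e i)).
- by rewrite -cmap_origin oe.
- exact/cmap_corner/ce.
have [|c [[oc pc] _]] := p_covering.2 v n cS; first by rewrite ocS.
have edges_c i : edge_at c [ffun=> false] i = e i.
  by apply: lift_eq; rewrite ?origin_edge_at ?oe // cmap_edge_at pc ecS.
exists c; split=> // c' [oc' ec']; apply: lift_eq; first by rewrite oc.
rewrite pc; apply: uniq_cS; rewrite -cmap_origin oc'; split=> // i.
by rewrite -cmap_edge_at ec'.
Qed.

Section VertexTransitive.
Variables (x0 : vertex X) (L : finType) (l : oedge X -> L).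
Hypothesis transitive : vertex_transitive p x0.
Hypothesis l_invariant : invariant_labeling l p x0.

Lemma quotient_one_vertex (v w : vertex S) : v = w.
Proof.
have vx0 u : u = p _ x0.
  have [x <-] := p_covering.1 u.
  by have [a [g [[pg _] <-]]] := transitive x0 x; rewrite pg.
by rewrite (vx0 v) (vx0 w).
Qed.

Lemma label_total : (forall s, exists e, l e = s) ->
  forall v s, exists e, origin e = v /\ l e = s.
Proof.
move=> l_surj v s; have [e <-] := l_surj s.
have [a [g [ag gv]]] := transitive (origin e) v.
by exists (g _ e); rewrite -cmap_origin gv (l_invariant ag).
Qed.

(** The deck transformation carrying [origin e] to [origin f] carries [e] to [f], by uniqueness of
    lifts. *)
Lemma label_quotient e f : p _ e = p _ f -> l e = l f.
Proof.
move=> pef; have [a [g [ag gv]]] := transitive (origin e) (origin f).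
rewrite -(l_invariant ag); congr l; apply: lift_eq; first by rewrite -cmap_origin.
by case: ag => ->.
Qed.

End VertexTransitive.
End Coverings.

(** * Rigidity of automorphisms when all labels commute *)

Section Flat.
Variables (X : cubeComplex) (Sigma0 : finType) (inv : Sigma0 -> Sigma0).
Variable l : oedge X -> Sigma0.
Hypothesis X_sc : simply_connected X.
Hypothesis X_npc : nonpositively_curved X.
Hypothesis invK : involutive inv.
Hypothesis inv_neq : forall s, inv s <> s.
Hypothesis l_adm : admissible inv l.
Hypothesis l_total : forall v s, exists e, origin e = v /\ l e = s.
Implicit Types (e f : oedge X) (v : vertex X).

Let l_inj e f : origin e = origin f -> l e = l f -> e = f.
Proof. by case: l_adm => _ linj _; exact: linj. Qed.

(** The exponent of [l e] rises by one along [e], hence along [f], which forces equal labels. *)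
Lemma edge_eq e f : origin e = origin f -> terminus e = terminus f -> e = f.
Proof.
move=> oef tef; apply: l_inj => //.
have [d [_ dE]] := exponent_sum X_sc invK l_adm (origin e) (l e).
have := dE e; rewrite oef tef dE => /addrI; rewrite exponent1 // /exponent.
by case: eqP => [->//|_]; case: eqP.
Qed.

Hypothesis all_commute :
  forall s t, s <> t -> s <> inv t -> commuting_labels l s t.

(* Agreement spreads along an edge [e]: every edge at the other end of [e],
   except the one labeled like [e], lies in a square with [e], and then the
   last one has only one image left. *)
Lemma flat_rigid v0 (g h : automorphism X) :
  g _ v0 = h _ v0 ->
  (forall e, origin e = v0 -> g _ (terminus e) = h _ (terminus e)) ->
  g = h.
Proof.
move=> gh0 gh1; pose agree v := g _ v = h _ v /\ forall e, origin e = v -> g _ e = h _ e.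
have agree_cell n (c : cell X n) : agree (origin c) -> g _ c = h _ c.
  case=> ghc ghe; apply: cell_eq => // [|i]; first by rewrite -!cmap_origin.
  by rewrite -!cmap_edge_at ghe // origin_edge_at.
have agreeP v : agree v.
  elim/(path_ind (v0 := v0)): v => //.
    split=> // e oe; apply: edge_eq; first by rewrite -!cmap_origin oe.
    by rewrite -!cmap_terminus gh1.
  move=> e [ghv ghe].
  have ge : g _ e = h _ e by exact: ghe.
  have ght : g _ (terminus e) = h _ (terminus e) by rewrite !cmap_terminus ge.
  split=> // f of_.
  have gh_neq f' : origin f' = terminus e -> l f' <> l e -> g _ f' = h _ f'.
    move=> of' fe; have l_redge : l (redge e) = inv (l e) by case: l_adm => -[_ ->].
    have [fe'|fe'] := eqVneq (l f') (inv (l e)).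
      have -> : f' = redge e by apply: l_inj; rewrite ?origin_redge ?l_redge.
      by rewrite !cmap_redge ge.
    have : corner (redge e) f'.
      apply/(commuting_corner X_sc X_npc invK inv_neq l_adm).
        by rewrite origin_redge.
      rewrite l_redge; apply: all_commute; first exact/nesym/eqP.
      by move/(inv_inj invK)/esym.
    case=> c [ec ->]; rewrite /sq_left !cmap_edge_at; congr edge_at.
    (* Seen from its corner [origin e], where agreement is known, the square has the same image
       under [g] and [h]. *)
    rewrite -(reflect_cubeK c [ffun j => j == ord0]) !cmap_face; congr face.
    rewrite -!cmap_face; apply: agree_cell; rewrite origin_face.
    suff -> : vertex_at c [ffun j => j == ord0] = origin e by [].
    rewrite -terminus_redge ec terminus_edge_at; congr vertex_at.
    by apply/ffunP => j; rewrite !ffunE.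
  (* For [f] labeled like [e], the edge [gi (h _ f)] either has that label too, hence is [f] by
     (A2), or falls under [gh_neq], and injectivity of [h] identifies it with [f]. *)
  have [fe|/eqP fe] := eqVneq (l f) (l e); last exact: gh_neq.
  have [gi _ giK] := aut_bij g 1.
  have of' : origin (gi (h _ f)) = terminus e.
    by apply: (bij_inj (aut_bij g 0)); rewrite ght -of_ !cmap_origin giK.
  have [fe'|/eqP fe'] := eqVneq (l (gi (h _ f))) (l e).
    have {1}-> : f = gi (h _ f) by apply: l_inj; rewrite ?of_ ?of' ?fe ?fe'.
    exact: giK.
  have := gh_neq _ of' fe'; rewrite giK => /(bij_inj (aut_bij h 1)) {1}->.
  exact: giK.
by apply: automorphism_eq => n c; exact/agree_cell/agreeP.
Qed.

Lemma flat_aut_discrete (R : realType) (v0 : vertex X) : discrete_space (Aut R X).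
Proof.
pose E s := sval (cid (l_total v0 s)).
have EP e : origin e = v0 -> E (l e) = e.
  move=> oe; rewrite /E; case: cid => f [of_ lf] /=.
  by apply: l_inj; rewrite ?of_ ?oe.
(* [v0] and its neighbors: a finite set, since there are finitely many labels. *)
apply: (aut_discrete (A := v0 :: [seq terminus (E s) | s <- enum Sigma0])) => g h gh.
apply: (@flat_rigid v0); first by apply: gh; rewrite inE eqxx.
move=> e oe; apply: gh; rewrite inE; apply/orP; right.
by rewrite -(EP e oe); apply: map_f; rewrite mem_enum.
Qed.

End Flat.

(** * The fundamental group *)

Section OneVertex.
Local Open Scope quotient_scope.
Variables (S : cubeComplex) (Sigma0 : finType) (inv : Sigma0 -> Sigma0).
Variables (comm : Sigma0 -> Sigma0 -> Prop) (l : oedge S -> Sigma0).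
Variable v0 : vertex S.
Implicit Types (e f : oedge S) (w : seq (oedge S)).
Hypothesis one_vertex : forall v v' : vertex S, v = v'.
Hypothesis invK : involutive inv.
Hypothesis inv_neq : forall s, inv s <> s.
Hypothesis l_redge : forall e, l (redge e) = inv (l e).
Hypothesis l_opp : forall e f, opposite e f -> l e = l f.
Hypothesis l_inj : injective l.
Hypothesis l_surj : forall s, exists e, l e = s.
Hypothesis l_comm : forall e f, corner e f <-> comm (l e) (l f).

Lemma one_vertex_path w : is_path v0 w v0.
Proof.
elim: w => //= e w IHw.
by rewrite (one_vertex (origin e) v0) (one_vertex (terminus e) v0) eqxx.
Qed.

Definition loop w : epath v0 v0 := exist _ w (one_vertex_path w).

Lemma loop_val (r : epath v0 v0) : r = loop (val r).
Proof. exact: val_inj. Qed.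

Let label_square (c : cell S 2) :
  l (sq_top c) = l (sq_bottom c) /\ l (sq_right c) = l (sq_left c).
Proof.
by split; apply/esym/l_opp; [exists c | exact: opposite_left_right].
Qed.

Lemma noncommuting_nonabelian s t :
  s <> t -> s <> inv t ->
  (forall a b, (a == s) || (a == inv s) -> (b == t) || (b == inv t) ->
     ~ comm a b /\ ~ comm b a) ->
  ~ (forall a b : pi1 v0, (a * b = b * a)%g).
Proof.
move=> st sit nst abelian.
have [[e le] [f lf]] := (l_surj s, l_surj t).
(* Being involutions, [A] and [B] serve a letter and its inverse alike. They do not commute, but no
   square has both an [s]-type and a [t]-type side. *)
pose A (y : bool * bool) := (y.2, y.1); pose B (y : bool * bool) := (~~ y.1, y.2).
pose K a y := if (a == s) || (a == inv s) then A y
              else if (a == t) || (a == inv t) then B y else y.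
have inv_pair a b : (inv a == b) || (inv a == inv b) = (a == b) || (a == inv b).
  by rewrite (can2_eq invK invK) (inj_eq (inv_inj invK)) orbC.
have actK y x : K (l (redge x)) (K (l x) y) = y.
  rewrite /K l_redge !inv_pair; case: (_ || _); first by case: y.
  by case: (_ || _) => //; case: y => y1 y2; rewrite /B /= negbK.
have actC y c : K (l (sq_right c)) (K (l (sq_bottom c)) y) =
                K (l (sq_top c)) (K (l (sq_left c)) y).
  have [-> ->] := label_square c.
  have /l_comm : corner (sq_bottom c) (sq_left c) by exists c.
  move: (l _) (l _) => a b; rewrite /K.
  case sa: ((a == s) || _); case sb: ((b == s) || _) => //=.
    by case tb: ((b == t) || _) => //; case: (nst _ _ sa tb).
    by case ta: ((a == t) || _) => //; case: (nst _ _ sb ta).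
  by case: (_ || _); case: (_ || _).
have homot : homotopic (loop [:: e; f]) (loop [:: f; e]).
  have := abelian (\pi_(pi1 v0) (loop [:: e])) (\pi_(pi1 v0) (loop [:: f])).
  rewrite -[LHS]/(pi1_mul _ _) -[RHS]/(pi1_mul _ _) !pi1_mulE => /pi1P.
  by rewrite (loop_val (Defs.cat_path _ _)) (loop_val (Defs.cat_path _ (loop [:: e]))).
(* From [(false, false)] the two orders of the letters lead to [(true, false)] and
   [(false, true)]. *)
have := homotopic_foldl (act := fun y x => K (l x) y) actK actC (false, false) homot.
rewrite /= le lf /K !eqxx /=.
have ts : (t == s) || (t == inv s) = false.
  apply/negP => /orP[/eqP ts|/eqP ts]; first by apply: st.
  by apply: sit; rewrite ts invK.
by rewrite ts.
Qed.

(** Homotopy without endpoints: over a single vertex every word is a loop, so subwords can be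
    rewritten freely. *)
Definition word_homotopic : seq (oedge S) -> seq (oedge S) -> Prop :=
  clos_refl_sym_trans _ (@elem_homotopy S).

Lemma word_homotopic_loop w w' :
  word_homotopic w w' -> homotopic (loop w) (loop w').
Proof.
elim=> {w w'} [w w' ww'|w|w w' _|w w' w'' _ h _ h'].
- exact: rst_step.
- exact: rst_refl.
- exact: rst_sym.
- exact: rst_trans h h'.
Qed.

Lemma word_homotopic_cat u w w' v :
  word_homotopic w w' -> word_homotopic (u ++ w ++ v) (u ++ w' ++ v).
Proof.
elim=> {w w'} [w w' ww'|w|w w' _|w w' w'' _ h _ h'].
- apply: rst_step; case: ww' => [p e q|p c q].
    by have := homotopy_backtrack (u ++ p) e (q ++ v); rewrite -!catA.
  by have := homotopy_square (u ++ p) c (q ++ v); rewrite -!catA.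
- exact: rst_refl.
- exact: rst_sym.
- exact: rst_trans h h'.
Qed.

(** * Commuting labels: exponents as coordinates of a free abelian group *)

Section Commuting.
Hypothesis all_commute : forall s t, s <> t -> s <> inv t -> comm s t.

Lemma backtrack_nil e : word_homotopic [:: e; redge e] [::].
Proof. by apply: rst_step; exact: (homotopy_backtrack [::]). Qed.

(** Equal or mutually inverse letters commute trivially. Otherwise they bound a square, whose
    opposite sides coincide because a label determines its edge. *)
Lemma letters_commute e f : word_homotopic [:: e; f] [:: f; e].
Proof.
have [/l_inj->|/eqP nef] := eqVneq (l e) (l f); first exact: rst_refl.
have [lef|/eqP nef'] := eqVneq (l e) (inv (l f)).
  have -> : e = redge f by apply: l_inj; rewrite l_redge.
  apply: rst_trans (rst_sym _ _ _ _ (backtrack_nil f)).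
  by have := backtrack_nil (redge f); rewrite redgeK.
have [c [-> ->]] := (l_comm e f).2 (all_commute nef nef').
have [lt lr] := label_square c.
have := rst_step _ _ _ _ (homotopy_square [::] c [::]) => /=.
by rewrite (l_inj lt) (l_inj lr).
Qed.

Lemma letter_last e w : word_homotopic (e :: w) (rcons w e).
Proof.
elim: w => [|f w IHw] /=; first exact: rst_refl.
apply: (@rst_trans _ _ _ (f :: e :: w)).
  exact: (word_homotopic_cat [::] w (letters_commute e f)).
by have := word_homotopic_cat [:: f] [::] IHw; rewrite !cats0.
Qed.

(** The inverse of the first letter must occur later, or the exponent of that letter would be
    positive. Moving the letter next to it cancels both; induction on a length bound. *)
Lemma zero_exponents_null w :
  (forall a, \sum_(e <- w) exponent inv a (l e) = 0)%R -> word_homotopic w [::].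
Proof.
move: {2}(size w) (leqnn (size w)) => k; elim: k w => [|k IHk] [|e w] //= wk sum0.
- exact: rst_refl.
- exact: rst_refl.
have : redge e \in w.
  apply: contraT => nw; have := sum0 (l e); rewrite big_cons exponent1 //.
  suff : (0 <= \sum_(f <- w) exponent inv (l e) (l f))%R.
    by move=> s0 /eqP; rewrite paddr_eq0 // oner_eq0.
  rewrite big_seq; apply: sumr_ge0 => f fw; rewrite /exponent.
  case: (eqVneq (l f) (inv (l e))) => [lf|_]; last by case: (_ == _).
  have fe : f = redge e by apply: l_inj; rewrite l_redge.
  by rewrite fe (negbTE nw) in fw.
move=> ew; case/splitPr: ew wk sum0 => w1 w2 wk sum0.
apply: (@rst_trans _ _ _ (w1 ++ w2)).
  apply: (@rst_trans _ _ _ (w1 ++ [:: e; redge e] ++ w2)).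
    have := word_homotopic_cat [::] (redge e :: w2) (letter_last e w1).
    by rewrite /= cat_rcons.
  exact: (word_homotopic_cat w1 w2 (backtrack_nil e)).
apply: IHk; first by move: wk; rewrite !size_cat /= addnS; lia.
move=> a; have := sum0 a; rewrite big_cons !big_cat /= big_cons l_redge.
by rewrite exponent_inv // => suma; rewrite -[RHS]suma; ring.
Qed.

(** One label out of each pair [a], [inv a], picked by rank: the basis of the free abelian group. *)
Definition positive_label := {a : Sigma0 | enum_rank a < enum_rank (inv a)}.

(** The final default [0] is never reached: [inv] has no fixed point, so [a] or [inv a] is
    positive. *)
Definition abelian_label (a : Sigma0) : {freeg positive_label} :=
  (if insub a is Some i then << i >>
   else if insub (inv a) is Some i then - << i >> else 0)%R.

Lemma coeff_abelian_label (i : positive_label) a :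
  coeff i (abelian_label a) = exponent inv (val i) a.
Proof.
rewrite /abelian_label /exponent; have iP := valP i.
case: insubP => [j aP <-|aN].
  rewrite coeffU mul1r val_eqE; case: (eqVneq (val j) (inv (val i))) => [ji|_].
    by have := valP j; rewrite /= ji invK => /(ltn_trans iP); rewrite ltnn.
  by rewrite subr0; case: (_ == _).
have -> : (a == val i) = false by apply: contraNF aN => /eqP ->.
have -> : (a == inv (val i)) = (inv a == val i) by rewrite (can2_eq invK invK).
case: insubP => [j _ <-|iaN].
  by rewrite coeffN coeffU mul1r val_eqE sub0r; case: (_ == _).
have -> : (inv a == val i) = false by apply: contraNF iaN => /eqP ->.
by rewrite coeff0.
Qed.

Lemma abelian_label_inv a : (abelian_label (inv a) = - abelian_label a)%R.
Proof.
apply/eqP/freeg_eqP => i.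
by rewrite coeffN !coeff_abelian_label exponent_inv.
Qed.

Definition abelian_sum w : {freeg positive_label} :=
  (\sum_(e <- w) abelian_label (l e))%R.

Lemma abelian_sum_homotopic (q r : epath v0 v0) :
  homotopic q r -> abelian_sum (val q) = abelian_sum (val r).
Proof.
move=> qr; pose act z e := (z + abelian_label (l e))%R.
have sumE w z : foldl act z w = (z + abelian_sum w)%R.
  rewrite /abelian_sum; elim: w z => [|e w IHw] z; first by rewrite big_nil addr0.
  by rewrite big_cons /= IHw /act addrA.
rewrite -[LHS]add0r -[RHS]add0r -!sumE; apply: homotopic_foldl => // [y e|y c].
  by rewrite /act l_redge abelian_label_inv addrK.
by have [lt lr] := label_square c; rewrite /act lt lr addrAC.
Qed.

Definition abelianization (x : pi1 v0) := abelian_sum (val (repr x)).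

Lemma abelianization_loop w :
  abelianization (\pi_(pi1 v0) (loop w)) = abelian_sum w.
Proof. exact: (abelian_sum_homotopic (repr_pi (loop w))). Qed.

Lemma pi1_loop (x : pi1 v0) : exists w, x = \pi_(pi1 v0) (loop w).
Proof. by exists (val (repr x)); rewrite -loop_val reprK. Qed.

Lemma loop_cat w w' :
  (\pi_(pi1 v0) (loop w) * \pi_(pi1 v0) (loop w'))%g = \pi_(pi1 v0) (loop (w ++ w')).
Proof. by rewrite -[LHS]/(pi1_mul _ _) pi1_mulE (loop_val (Defs.cat_path _ _)). Qed.

Lemma abelianizationM x y :
  abelianization (x * y)%g = (abelianization x + abelianization y)%R.
Proof.
have [[w ->] [w' ->]] := (pi1_loop x, pi1_loop y).
by rewrite loop_cat !abelianization_loop /abelian_sum big_cat.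
Qed.

Lemma abelianization_ker x : abelianization x = 0%R -> x = 1%g.
Proof.
have [w ->] := pi1_loop x; rewrite abelianization_loop => w0.
apply/pi1P; rewrite (loop_val (nil_path _)).
apply: word_homotopic_loop; apply: zero_exponents_null => a.
(* Vanishing coefficients control the positive labels only; the exponent of any other label is minus
   that of its inverse. *)
suff pos b : enum_rank b < enum_rank (inv b) ->
    (\sum_(e <- w) exponent inv b (l e) = 0)%R.
  have [/pos//|lt_ia|/ord_inj/enum_rank_inj/esym/inv_neq//] :=
    ltngtP (enum_rank a) (enum_rank (inv a)).
  have : (\sum_(e <- w) exponent inv (inv a) (l e) = 0)%R by apply: pos; rewrite invK.
  move/eqP; rewrite -oppr_eq0 -sumrN => /eqP s0; rewrite -[RHS]s0.
  by apply: eq_bigr => e _; rewrite /exponent opprB invK.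
move=> bP; pose i : positive_label := Sub b bP.
have := congr1 (coeff i) w0; rewrite /abelian_sum raddf_sum coeff0 => s0.
rewrite -[RHS]s0; apply: eq_bigr => e _.
by rewrite /= coeff_abelian_label.
Qed.

Lemma abelianization_inj : injective abelianization.
Proof.
move=> x y xy; have VD z : abelianization (z^-1)%g = (- abelianization z)%R.
  apply/eqP; rewrite -addr_eq0 -abelianizationM mulVg.
  by rewrite -[1%g]/(\pi_(pi1 v0) (nil_path v0)) (loop_val (nil_path v0))
    abelianization_loop /abelian_sum big_nil.
have /abelianization_ker : abelianization (x * y^-1)%g = 0%R.
  by rewrite abelianizationM VD xy subrr.
by move/(congr1 (fun z => z * y)%g); rewrite -mulgA mulVg mulg1 mul1g.
Qed.

Lemma abelianization_surj D : exists x, abelianization x = D.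
Proof.
suff [w <-] : exists w, abelian_sum w = D.
  by exists (\pi_(pi1 v0) (loop w)); exact: abelianization_loop.
elim/freeg_ind_dom0: D => [|k i D _ _ [w <-]].
  by exists [::]; rewrite /abelian_sum big_nil.
suff [w' <-] : exists w', abelian_sum w' = << k *g i >>%R.
  by exists (w' ++ w); rewrite /abelian_sum big_cat.
have [e le] := l_surj (val i).
have lab : abelian_label (l e) = << i >>%R by rewrite /abelian_label le valK.
elim/int_rec: k => [|k [w' w'k]|k [w' w'k]].
- by exists [::]; rewrite /abelian_sum big_nil freegU0.
- exists (e :: w'); rewrite /abelian_sum big_cons lab -/(abelian_sum w') w'k.
  by rewrite freegUD -intS.
- exists (redge e :: w'); rewrite /abelian_sum big_cons l_redge abelian_label_inv.
  by rewrite lab -/(abelian_sum w') w'k freegUN freegUD -opprD -intS.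
Qed.

(** [phi] is a section of [abelianization]; injectivity of the latter makes it a two-sided inverse
    and additive. *)
Lemma commuting_free_abelian : free_abelian (pi1 v0).
Proof.
have [phi phiK] := choice abelianization_surj.
exists positive_label, phi; split.
  exists abelianization; first exact: phiK.
  by move=> x; apply: abelianization_inj; rewrite phiK.
by move=> D D'; apply: abelianization_inj; rewrite abelianizationM !phiK.
Qed.

End Commuting.
End OneVertex.

(* Squares of S lift to X, so commutation of labels can be read off in S. *)
Lemma quotient_labeling (X S : cubeComplex) (p : cubical_map X S)
    (x0 : vertex X) (Sigma0 : finType) (inv : Sigma0 -> Sigma0)
    (l : oedge X -> Sigma0) :
  universal_covering p -> nonpositively_curved X ->
  involutive inv -> (forall s, inv s <> s) -> admissible inv l ->
  (forall s, exists e, l e = s) -> invariant_labeling l p x0 ->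
  vertex_transitive p x0 ->
  exists lS : oedge S -> Sigma0,
    [/\ forall e, lS (redge e) = inv (lS e),
        forall e f, opposite e f -> lS e = lS f,
        injective lS, forall s, exists e, lS e = s &
        forall e f, corner e f <-> commuting_labels l (lS e) (lS f)].
Proof.
move=> [p_cov X_sc] X_npc invK inv_neq l_adm l_surj l_inv trans.
have l_redge e : l (redge e) = inv (l e) by case: l_adm => -[_ ->].
have l_inj e f : origin e = origin f -> l e = l f -> e = f.
  by case: l_adm => _ + _; apply.
have vS := quotient_one_vertex p_cov trans.
have lift n (c : cell S n) : exists c' : cell X n, origin c' = x0 /\ p _ c' = c.
  by have [|c' [? _]] := p_cov.2 x0 n c; [exact: vS | exists c'].
have [L LP] := choice (@lift 1).
have oL e : origin (L e) = x0 := (LP e).1.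
have pL e : p _ (L e) = e := (LP e).2.
pose lS e := l (L e).
(* Any lift of an edge may be used to read its label, not only the chosen one at [x0]. *)
have lSE e : lS (p _ e) = l e.
  by apply: (label_quotient p_cov trans l_inv); rewrite pL.
exists lS; split.
- by move=> e; rewrite -{1}(pL e) -cmap_redge lSE l_redge.
- move=> _ _ [c [-> ->]]; have [c' [_ <-]] := lift 2 c.
  rewrite /sq_bottom /sq_top -!cmap_edge_at !lSE.
  by case: l_adm => -[lpar _] _ _; apply/lpar/rst_step; exists c'.
- move=> e f lef; rewrite -(pL e) -(pL f); congr (p _ _).
  by apply: l_inj; rewrite ?oL.
- by move=> s; have [e <-] := l_surj s; exists (p _ e).
- move=> e f; have oef : origin (L e) = origin (L f) by rewrite !oL.
  rewrite /lS (commuting_corner X_sc X_npc invK inv_neq l_adm oef).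
  split=> [ef|/(cmap_corner p)]; last by rewrite !pL.
  by apply: (lift_corner p_cov oef); rewrite !pL.
Qed.

(** * Equivalence of non-discreteness, non-commuting labels and failure of free abelianness *)

Theorem theorem5 (R : realType) (S X : cubeComplex) (p : cubical_map X S)
    (x0 : vertex X) (Sigma0 : finType) (inv : Sigma0 -> Sigma0)
    (l : oedge X -> Sigma0)
    (S_compact : compact [set: realization R S])
    (S_connected : connected [set: realization R S])
    (S_npc : nonpositively_curved S)
    (S_special : special S)
    (p_universal : universal_covering p)
    (inv_involutive : involutive inv)
    (inv_fixfree : forall s, inv s <> s)
    (l_admissible : admissible inv l)
    (l_surjective : forall s, exists e, l e = s)
    (l_invariant : invariant_labeling l p x0)
    (transitive : vertex_transitive p x0) :
  (~ discrete_space (Aut R X) <->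
   exists s t : Sigma0, [/\ s <> t, s <> inv t & ~ commuting_labels l s t]) /\
  ((exists s t : Sigma0, [/\ s <> t, s <> inv t & ~ commuting_labels l s t]) <->
   ~ free_abelian (pi1 (p 0 x0))).
Proof.
have [p_cov X_sc] := p_universal.
have X_npc := nonpositively_curved_cover p_cov S_npc.
have l_total := label_total transitive l_invariant l_surjective.
have commI s t := @commuting_invl _ _ _ _ X_sc X_npc inv_involutive inv_fixfree
  l_admissible s t.
have commIr s t := @commuting_invr _ _ _ _ X_sc X_npc inv_involutive inv_fixfree
  l_admissible s t.
have commC s t := @commuting_sym _ _ _ _ X_sc X_npc inv_involutive inv_fixfree
  l_admissible s t.
have [lS [lS_redge lS_opp lS_inj lS_surj lS_comm]] := quotient_labeling
  p_universal X_npc inv_involutive inv_fixfree l_admissible l_surjective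
  l_invariant transitive.
have S_vertex := quotient_one_vertex p_cov transitive.
have not2 : ~ (exists s t, [/\ s <> t, s <> inv t & ~ commuting_labels l s t]) ->
    forall s t, s <> t -> s <> inv t -> commuting_labels l s t.
  move=> n2 s t st sit; apply: contrapT => nst.
  by apply: n2; exists s, t.
split; split.
- apply: contra_notP => /not2 comm.
  exact: (flat_aut_discrete X_sc X_npc inv_involutive inv_fixfree l_admissible
    l_total comm x0).
- move=> [s [t [st sit nst]]]; apply: (aut_not_discrete (v0 := x0)) => // N.
  exact: (swap_automorphism X_sc X_npc inv_involutive inv_fixfree l_admissible
    l_total x0 N st sit nst).
- move=> [s [t [st sit nst]]] [I [phi [phi_bij phiD]]].
  apply: (noncommuting_nonabelian (v0 := p 0%N x0) S_vertex inv_involutive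
    lS_redge lS_opp lS_surj lS_comm st sit).
    (* Commutation is insensitive to inverting either label, so no sign variants of [s] and [t]
       commute. *)
    move=> a b sa tb; suff nab : ~ commuting_labels l a b by split=> // /commC.
    move=> ab; apply: nst.
    have sb : commuting_labels l s b.
      case/orP: sa ab => /eqP -> //= /commI; by rewrite inv_involutive.
    case/orP: tb sb => /eqP -> //= /commIr; by rewrite inv_involutive.
  (* Commutativity of addition is transported through [phi], so a free abelian group is abelian. *)
  have [psi phiK psiK] := phi_bij => a b.
  by rewrite -(psiK a) -(psiK b) -!phiD addrC.
- apply: contra_notP => /not2 comm.
  exact: (commuting_free_abelian (p 0%N x0) S_vertex inv_involutive inv_fixfree
    lS_redge lS_opp lS_inj lS_surj lS_comm comm).
Qed.
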